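(* Suppose that $\mathsf H:\mathcal H\to\mathbb R$ is locally Lipschitz. Let $u:\mathbb R_+\times\mathcal C\to\mathbb R$ be a Lipschitz viscosity subsolution and $v:\mathbb R_+\times\mathcal C\to\mathbb R$ be a Lipschitz viscosity supersolution of $\mathrm{HJ}(\mathcal H,\mathcal C,\mathsf H)$. If $u(0,\cdot)\le v(0,\cdot)$, then $u\le v$.
   Context: $\mathbb R_+=[0,\infty)$. Fix an integer $D\ge1$. $\mathbb S^D$ is the space of real symmetric $D\times D$ matrices with inner product $a\cdot b=\mathrm{tr}(ab)$ and norm $|a|=\sqrt{a\cdot a}$; $\mathbb S^D_+$ is the cone of positive semidefinite matrices. $\mathcal H=L^2([0,1);\mathbb S^D)$ (Lebesgue measure) with $\langle\iota,\kappa\rangle_{\mathcal H}=\int_0^1\iota(s)\cdot\kappa(s)\,ds$ and norm $|\cdot|_{\mathcal H}$. $\mathcal C\subset\mathcal H$ is the closed convex cone of (classes of) functions $\mu:[0,1)\to\mathbb S^D_+$ that are square-integrable, right-continuous with left limits, and increasing, i.e. $\mu(t)-\mu(s)\in\mathbb S^D_+$ for $t\ge s$. Lipschitz for $u,v$ means Lipschitz jointly in $(t,\mu)$ with respect to the norm of $\mathbb R\times\mathcal H$; Lipschitzness of $\mathsf H$ is with respect to $|\cdot|_{\mathcal H}$. Viscosity solutions. A function $\phi:(0,\infty)\times\mathcal C\to\mathbb R$ is smooth if at every $(t,x)$ there is a unique $(\partial_t\phi(t,x),\nabla\phi(t,x))\in\mathbb R\times\mathcal H$ with $\phi(s,y)-\phi(t,x)=\partial_t\phi(t,x)(s-t)+\langle\nabla\phi(t,x),y-x\rangle_{\mathcal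 H}+o(|s-t|+|y-x|_{\mathcal H})$ as $(s,y)\to(t,x)$ in $(0,\infty)\times\mathcal C$, the error is in fact $O(|s-t|^2+|y-x|^2_{\mathcal H})$ at every point, and $(t,x)\mapsto(\partial_t\phi(t,x),\nabla\phi(t,x))$ is continuous. A continuous $f:\mathbb R_+\times\mathcal C\to\mathbb R$ is a viscosity subsolution (resp. supersolution) of $\mathrm{HJ}(\mathcal H,\mathcal C,\mathsf H)$ (the equation $\partial_tf-\mathsf H(\nabla f)=0$ on $\mathbb R_+\times\mathcal C$) if for every $(t,x)\in(0,\infty)\times\mathcal C$ and every smooth $\phi$ such that $f-\phi$ has a local maximum (resp. minimum) at $(t,x)$ relative to $(0,\infty)\times\mathcal C$, one has $(\partial_t\phi-\mathsf H(\nabla\phi))(t,x)\le0$ (resp. $\ge0$). *)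

(* Defs.v *)
From HB Require Import structures.
From mathcomp Require Import all_boot all_order all_algebra.
From mathcomp Require Import generic_quotient ring_quotient.
From mathcomp Require Import ring lra.
From mathcomp Require Import all_classical all_reals all_analysis.

Set Implicit Arguments.
Unset Strict Implicit.
Unset Printing Implicit Defensive.

Import Order.TTheory GRing.Theory Num.Theory.
Import numFieldNormedType.Exports.

Local Open Scope classical_set_scope.
Local Open Scope ring_scope.
Local Open Scope quotient_scope.

Section SymL2.
Variables (R : realType) (D : nat).

Definition lebesgue01 : {measure set (measurableTypeR R) -> \bar R} :=
  mrestr (@lebesgue_measure R) (measurable_itv `[(0 : R), 1[).

Local Notation mu := lebesgue01.

(* A function on [0,1) is represented by a function on R whose values outside
   [0,1) are irrelevant, lebesgue01 vanishing there. *)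
Definition symL2_pred : {pred R -> 'M[R]_D} := fun f =>
  `[< (forall s, (f s)^T = f s) /\
      (forall i j, (fun s => f s i j) \in Lfun mu 2%:E) >].

Lemma symL2P f : reflect ((forall s, (f s)^T = f s) /\
  (forall i j, (fun s => f s i j) \in Lfun mu 2%:E)) (f \in symL2_pred).
Proof. exact: asboolP. Qed.

Lemma symL2_submod_closed : submod_closed symL2_pred.
Proof.
have [L0 LD] := Lfun_submod_closed mu (lee1n 2).
split.
  apply/symL2P; split=> [s|i j]; first exact: trmx0.
  rewrite [X in X \in _](_ : _ = 0) //.
  by apply/funext => s; exact: mxE.
move=> a f g /symL2P[fs fL] /symL2P[gs gL]; apply/symL2P; split=> [s|i j].
  by rewrite [(_ + _) s]/(a *: f s + g s) linearP /= fs gs.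
rewrite [X in X \in _](_ : _ = a *: (fun s => f s i j) + (fun s => g s i j)).
  exact: LD.
by apply/funext => s; rewrite !mxE.
Qed.

HB.instance Definition _ :=
  GRing.isSubmodClosed.Build _ _ symL2_pred symL2_submod_closed.

Record symL2_fun := SymL2Fun {
  symL2_val :> R -> 'M[R]_D;
  symL2_valP : symL2_val \in symL2_pred }.

HB.instance Definition _ := [isSub for symL2_val].
HB.instance Definition _ := [Choice of symL2_fun by <:].
HB.instance Definition _ := [SubChoice_isSubLmodule of symL2_fun by <:].

Implicit Types f g h : symL2_fun.

Lemma symL2_funP a f g s : (a *: f + g) s = a *: f s + g s.
Proof. by []. Qed.

Lemma symL2_funB f g s : (f - g) s = f s - g s.
Proof. by []. Qed.

Lemma symL2_sym f s : (f s)^T = f s.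
Proof. by have /symL2P[] := symL2_valP f. Qed.

Lemma symL2_Lfun f i j : (fun s => f s i j) \in Lfun mu 2%:E.
Proof. by have /symL2P[_] := symL2_valP f. Qed.

#[global] Instance lebesgue01_filter : Filter (almost_everywhere mu).
Proof. exact: ae_filter_ringOfSetsType. Qed.

Definition symL2_ae0 : {pred symL2_fun} :=
  fun f => `[< {ae mu, forall s, f s = 0} >].

Lemma symL2_ae0P f : reflect {ae mu, forall s, f s = 0} (f \in symL2_ae0).
Proof. exact: asboolP. Qed.

Lemma symL2_ae0_submod_closed : submod_closed symL2_ae0.
Proof.
split; first by apply/symL2_ae0P/aeW.
move=> a f g /symL2_ae0P f0 /symL2_ae0P g0; apply/symL2_ae0P.
apply: (filterS2 _ _ f0 g0) => s fs0 gs0.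
by rewrite symL2_funP fs0 gs0 scaler0 addr0.
Qed.

HB.instance Definition _ :=
  GRing.isSubmodClosed.Build _ _ symL2_ae0 symL2_ae0_submod_closed.

Definition symL2 := Quotient.quot symL2_ae0.
HB.instance Definition _ := Choice.on symL2.
HB.instance Definition _ := EqQuotient.on symL2.
HB.instance Definition _ := GRing.Zmodule.on symL2.


Definition symL2_scale (a : R) (x : symL2) : symL2 := \pi_(symL2) (a *: repr x).

Lemma eq_symL2P f g :
  \pi_(symL2) f = \pi_(symL2) g <-> {ae mu, forall s, f s = g s}.
Proof.
have -> : (\pi_(symL2) f = \pi_(symL2) g) <-> {ae mu, forall s, (f - g) s = 0}.
  split=> [/eqP|h]; first by rewrite -Quotient.idealrBE => /symL2_ae0P.
  by apply/eqP; rewrite -Quotient.idealrBE; apply/symL2_ae0P.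
split; apply: filterS => s.
  by move/eqP; rewrite symL2_funB subr_eq0 => /eqP.
by move=> fg; rewrite symL2_funB fg subrr.
Qed.

Lemma pi_symL2_scale a f : symL2_scale a (\pi_(symL2) f) = \pi_(symL2) (a *: f).
Proof.
apply/eqP; rewrite -Quotient.idealrBE -scalerBr rpredZ//.
by rewrite Quotient.idealrBE reprK.
Qed.

Lemma pi_symL2D f g : \pi_(symL2) (f + g) = \pi_(symL2) f + \pi_(symL2) g.
Proof. by rewrite !piE. Qed.

Lemma symL2_ind (P : symL2 -> Prop) : (forall f, P (\pi_(symL2) f)) -> forall x, P x.
Proof. by move=> Pf x; rewrite -[x]reprK. Qed.

Fact symL2_scalerA a b x : symL2_scale a (symL2_scale b x) = symL2_scale (a * b) x.
Proof. by elim/symL2_ind: x => f; rewrite !pi_symL2_scale scalerA. Qed.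

Fact symL2_scale1r : left_id 1 symL2_scale.
Proof. by elim/symL2_ind => f; rewrite pi_symL2_scale scale1r. Qed.

Fact symL2_scalerDr : right_distributive symL2_scale +%R.
Proof.
move=> a; elim/symL2_ind => f; elim/symL2_ind => g.
by rewrite -pi_symL2D !pi_symL2_scale -pi_symL2D scalerDr.
Qed.

Fact symL2_scalerDl x : {morph symL2_scale^~ x : a b / a + b}.
Proof.
move=> a b; elim/symL2_ind: x => f.
by rewrite !pi_symL2_scale -pi_symL2D scalerDl.
Qed.

HB.instance Definition _ := GRing.Zmodule_isLmodule.Build R symL2
  symL2_scalerA symL2_scale1r symL2_scalerDr symL2_scalerDl.

Definition symL2_repr (x : symL2) : R -> 'M[R]_D := repr x.
Local Coercion symL2_repr : symL2 >-> Funclass.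

Definition symL2_dot (x y : symL2) : R := \int[mu]_s \tr (x s *m y s).

Lemma symL2_reprE f : {ae mu, forall s, symL2_repr (\pi_(symL2) f) s = f s}.
Proof. by apply/eq_symL2P; rewrite reprK. Qed.

Lemma symL2_integrable f g :
  mu.-integrable setT (EFin \o (fun s => \tr (f s *m g s))).
Proof.
apply/Lfun1_integrable.
have [L0 LD] := Lfun_submod_closed mu (@lexx _ _ (1 : \bar R)%E).
rewrite [X in X \in _](_ : _ =
  \sum_i \sum_j (fun s => f s i j) \* (fun s => g s j i)); last first.
  apply/funext => s; rewrite /mxtrace fct_sumE; apply: eq_bigr => i _.
  by rewrite mxE fct_sumE.
have LDr (p q : R -> R) : p \in Lfun mu 1%:E -> q \in Lfun mu 1%:E ->
    p + q \in Lfun mu 1%:E.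
  by move=> pL qL; rewrite -[p]scale1r; exact: LD.
apply: (@big_ind _ (fun p : R -> R => p \in Lfun mu 1%:E)) => // i _.
apply: (@big_ind _ (fun p : R -> R => p \in Lfun mu 1%:E)) => // j _.
by apply: Lfun2_mul_Lfun1; exact: symL2_Lfun.
Qed.

Lemma symL2_dotE f g :
  symL2_dot (\pi_(symL2) f) (\pi_(symL2) g) = \int[mu]_s \tr (f s *m g s).
Proof.
congr fine; apply: ae_eq_integral => //.
- exact: measurable_int (symL2_integrable _ _).
- exact: measurable_int (symL2_integrable _ _).
- apply: (filterS2 _ _ (symL2_reprE f) (symL2_reprE g)) => s /= -> -> //.
Qed.

Lemma symL2_dotC x y : symL2_dot x y = symL2_dot y x.
Proof. by apply: eq_Rintegral => s _; rewrite mxtrace_mulC. Qed.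

Lemma symL2_dot_linear a x y z :
  symL2_dot (a *: x + y) z = a * symL2_dot x z + symL2_dot y z.
Proof.
elim/symL2_ind: x => f; elim/symL2_ind: y => g; elim/symL2_ind: z => h.
rewrite [_ *: _]pi_symL2_scale -pi_symL2D !symL2_dotE.
rewrite -RintegralZl//; last exact: symL2_integrable.
rewrite -RintegralD//; last 2 first.
- by have := symL2_integrable (a *: f) h;
     under eq_fun do rewrite /= -scalemxAl mxtraceZ.
- exact: symL2_integrable.
apply: eq_Rintegral => s _.
by rewrite symL2_funP mulmxDl -scalemxAl mxtraceD mxtraceZ.
Qed.

Lemma mxtrace_sym (A : 'M[R]_D) : A^T = A ->
  \tr (A *m A) = \sum_i \sum_j (A i j) ^+ 2.
Proof.
move=> sA; apply: eq_bigr => i _; rewrite mxE; apply: eq_bigr => j _.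
by rewrite -[in X in _ * X]sA mxE -expr2.
Qed.

Lemma mxtrace_sym_ge0 (A : 'M[R]_D) : A^T = A -> 0 <= \tr (A *m A).
Proof.
by move=> /mxtrace_sym->; do 2!apply: sumr_ge0 => ? _; exact: sqr_ge0.
Qed.

Lemma symL2_dot_ge0 x : 0 <= symL2_dot x x.
Proof.
by apply: Rintegral_ge0 => s _; apply: mxtrace_sym_ge0; exact: symL2_sym.
Qed.

Lemma symL2_dot_eq0 x : symL2_dot x x = 0 -> x = 0.
Proof.
elim/symL2_ind: x => f; rewrite symL2_dotE => f0.
have [mf _] := integrableP _ _ _ (symL2_integrable f f).
have /(ae_eq_integral_abs mu measurableT mf) f00 :
    (\int[mu]_s `|(EFin \o (fun s => \tr (f s *m f s))) s| = 0)%E.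
  under eq_integral.
    by move=> s _; rewrite gee0_abs ?lee_fin ?mxtrace_sym_ge0 ?symL2_sym//; over.
  rewrite -[LHS]fineK; first by rewrite [fine _]f0.
  exact: integrable_fin_num (symL2_integrable f f).
have -> : 0 = \pi_(symL2) 0 :> symL2 by rewrite !piE.
apply/eq_symL2P; apply: filterS f00 => s /(_ I) /=.
move=> /(congr1 fine) /=; rewrite mxtrace_sym ?symL2_sym// => /eqP.
rewrite psumr_eq0; last by move=> i _; apply: sumr_ge0 => j _; exact: sqr_ge0.
move=> /allP fs0; apply/matrixP => i j; rewrite [RHS]mxE.
have /implyP/(_ isT) := fs0 i (mem_index_enum i).
rewrite psumr_eq0; last by move=> k _; exact: sqr_ge0.
by move=> /allP/(_ j (mem_index_enum j)); rewrite /= sqrf_eq0 => /eqP.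
Qed.

Definition symL2_norm (x : symL2) : R := Num.sqrt (symL2_dot x x).

Lemma symL2_dotD x y z : symL2_dot (x + y) z = symL2_dot x z + symL2_dot y z.
Proof. by rewrite -[x in LHS]scale1r symL2_dot_linear mul1r. Qed.

Lemma symL2_dot0 z : symL2_dot 0 z = 0.
Proof. by apply: (addrI (symL2_dot 0 z)); rewrite -symL2_dotD !addr0. Qed.

Lemma symL2_dotZ a x z : symL2_dot (a *: x) z = a * symL2_dot x z.
Proof. by rewrite -[_ *: _]addr0 symL2_dot_linear symL2_dot0 addr0. Qed.

Lemma symL2_CauchySchwarz x y :
  symL2_dot x y <= symL2_norm x * symL2_norm y.
Proof.
have [/symL2_dot_eq0->|y0] := eqVneq (symL2_dot y y) 0.
  by rewrite symL2_dotC symL2_dot0 mulr_ge0// sqrtr_ge0.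
have yy : 0 < symL2_dot y y by rewrite lt_def y0 symL2_dot_ge0.
rewrite /symL2_norm -sqrtrM ?symL2_dot_ge0// (le_trans (ler_norm _))//.
rewrite -sqrtr_sqr ler_wsqrtr//.
have := symL2_dot_ge0 (symL2_dot y y *: x + (- symL2_dot x y) *: y).
rewrite symL2_dot_linear symL2_dotZ.
rewrite ![symL2_dot _ (_ + _)]symL2_dotC !symL2_dot_linear !symL2_dotZ.
rewrite (symL2_dotC y x); set a := symL2_dot x x; set b := symL2_dot x y.
set c := symL2_dot y y.
have -> : c * (c * a + - b * b) + - b * (c * b + - b * c) =
          c * (a * c - b ^+ 2) by ring.
by rewrite pmulr_rge0// subr_ge0.
Qed.

Fact symL2_ler_normD x y : symL2_norm (x + y) <= symL2_norm x + symL2_norm y.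
Proof.
rewrite -ler_sqr ?nnegrE ?addr_ge0 ?sqrtr_ge0// sqrrD !sqr_sqrtr ?symL2_dot_ge0//.
rewrite symL2_dotD ![symL2_dot _ (_ + _)]symL2_dotC !symL2_dotD (symL2_dotC y x).
have := symL2_CauchySchwarz x y; set b := symL2_dot x y.
by rewrite mulr2n => h; lra.
Qed.

Fact symL2_normrZ a x : symL2_norm (a *: x) = `|a| * symL2_norm x.
Proof.
rewrite /symL2_norm symL2_dotZ symL2_dotC symL2_dotZ mulrA -expr2.
by rewrite sqrtrM ?sqr_ge0// sqrtr_sqr.
Qed.

Fact symL2_normr0_eq0 x : symL2_norm x = 0 -> x = 0.
Proof.
move=> /eqP; rewrite sqrtr_eq0 => x0; apply: symL2_dot_eq0.
by apply: le_anti; rewrite x0 symL2_dot_ge0.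
Qed.

HB.instance Definition _ := Lmodule_isNormed.Build R symL2
  symL2_ler_normD symL2_normrZ symL2_normr0_eq0.

Lemma symL2_normE x : `|x| = Num.sqrt (symL2_dot x x).
Proof. by []. Qed.

End SymL2.

Coercion symL2_repr : symL2 >-> Funclass.

Section HamiltonJacobi.
Variables (R : realType) (D : nat).

Local Notation H := (symL2 R D).

Definition psdmx (A : 'M[R]_D) : Prop :=
  A^T = A /\ forall v : 'rV[R]_D, 0 <= (v *m A *m v^T) 0 0.

(* The paths need only be defined on [0,1): membership of x in H already
   provides measurability and square-integrability of any representative. *)
Definition cone : set H := [set x | exists2 m : R -> 'M[R]_D,
  {ae lebesgue01 R, forall s, x s = m s} &
  [/\ forall s, s \in `[0, 1[ -> psdmx (m s),
      forall s t, s \in `[0, 1[ -> t \in `[0, 1[ -> s <= t ->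
        psdmx (m t - m s),
      forall s, s \in `[0, 1[ -> m r @[r --> s^'+] --> m s &
      forall s, s \in `]0, 1[ -> cvg (m r @[r --> s^'-])]].

Definition nonneg_cone : set (R * H) := [set t | 0 <= t] `*` cone.

Definition pos_cone : set (R * H) := [set t | 0 < t] `*` cone.

(* Functions on nonneg_cone or pos_cone are total functions on R * H whose
   values elsewhere are never used. *)

Definition locally_lipschitz (F : H -> R) : Prop :=
  forall x : H, exists2 U, nbhs x U & [lipschitz F y | y in U].

Definition jet_error (phi : R * H -> R) (z d w : R * H) : R :=
  phi w - phi z - (d.1 * (w.1 - z.1) + symL2_dot d.2 (w.2 - z.2)).

Definition has_jet (phi : R * H -> R) (z d : R * H) : Prop :=
  jet_error phi z d =o_ (within pos_cone (nbhs z))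
    (fun w => `|w.1 - z.1| + `|w.2 - z.2|).

(* The pair (time derivative, spatial gradient); meaningful where has_jet has
   exactly one solution, as smooth_on_cone requires. *)
Definition jet (phi : R * H -> R) (z : R * H) : R * H := xget 0 (has_jet phi z).

Definition dt (phi : R * H -> R) (z : R * H) : R := (jet phi z).1.

Definition grad (phi : R * H -> R) (z : R * H) : H := (jet phi z).2.

Definition smooth_on_cone (phi : R * H -> R) : Prop :=
  [/\ forall z, pos_cone z -> exists! d, has_jet phi z d,
      forall z, pos_cone z ->
        jet_error phi z (jet phi z) =O_ (within pos_cone (nbhs z))
          (fun w => `|w.1 - z.1| ^+ 2 + `|w.2 - z.2| ^+ 2) &
      {within pos_cone, continuous (jet phi)}].

Definition viscosity_subsolution (F : H -> R) (f : R * H -> R) : Prop :=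
  {within nonneg_cone, continuous f} /\
  forall (z : R * H) (phi : R * H -> R), pos_cone z -> smooth_on_cone phi ->
    (\forall w \near within pos_cone (nbhs z), f w - phi w <= f z - phi z) ->
    dt phi z - F (grad phi z) <= 0.

Definition viscosity_supersolution (F : H -> R) (f : R * H -> R) : Prop :=
  {within nonneg_cone, continuous f} /\
  forall (z : R * H) (phi : R * H -> R), pos_cone z -> smooth_on_cone phi ->
    (\forall w \near within pos_cone (nbhs z), f z - phi z <= f w - phi w) ->
    0 <= dt phi z - F (grad phi z).

End HamiltonJacobi.

Arguments cone : clear implicits.
Arguments nonneg_cone : clear implicits.
Arguments pos_cone : clear implicits.

(* Main.v *)
Require Import Defs.
From mathcomp Require Import all_boot all_order all_algebra.
From mathcomp Require Import ring lra.
From mathcomp Require Import all_classical all_reals all_analysis.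
From mathcomp Require Import measurable_realfun.

(* Suppose u > v at some point.  Doubling the variables, one studies
   Phi = u(t,x) - v(s,y) - a|x-y|^2 - a(t-s)^2 - mu(t+t^2), whose supremum
   exceeds its values at t = 0 or s = 0.  At an exact maximum, the gradients
   tested for u and v would both be 2a(x-y) while the time derivatives differ by
   at least mu, a contradiction.  As H is infinite-dimensional, Phi need not
   attain its supremum; perturbing it separates the two gradients, and F, being
   only locally Lipschitz, need not be uniformly continuous on bounded sets.
   So closeness of the gradients is measured at a fixed point.  A first
   Borwein-Preiss perturbation, quadratic in x-y alone, makes x-y converge in
   norm along every maximizing sequence, which fixes a limit gradient q.  A
   second one, quadratic in all four variables and small relative to the modulus
   of continuity of F at q, then produces an exact maximum at which both
   gradients are close to q.

   The test functions are quadratic.  They are smooth in the required sense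
   because jets are unique: the cone contains the paths 1_[a,1) A with A
   positive semidefinite, whose orthogonal is zero. *)

Set Implicit Arguments.
Unset Strict Implicit.
Unset Printing Implicit Defensive.

Import Order.TTheory GRing.Theory Num.Theory.
Import numFieldNormedType.Exports.

Local Open Scope classical_set_scope.
Local Open Scope ring_scope.

(** * The orthogonal of the cone *)

Section Orthogonality.
Variables (R : realType) (D : nat).
Local Notation mu := (lebesgue01 R).
Local Notation H := (symL2 R D).

(** A Dynkin argument: the rays [a, +oo[ are stable under intersection and generate the Borel sets,
    while the sets over which [g] integrates to 0 are stable under complement, thanks to the total
    integral, and under countable disjoint unions. *)
Lemma integral_rays_eq0 (nu : {measure set (measurableTypeR R) -> \bar R})
    (g : R -> \bar R) : nu.-integrable setT g ->
  (\int[nu]_x g x = 0)%E -> (forall a, \int[nu]_(x in `[a, +oo[) g x = 0)%E ->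
  ae_eq nu setT g (cst 0%E).
Proof.
move=> gi gT gray; apply: integral_ae_eq => // E _ mE.
rewrite integral0.
have gi' : forall S : set R, measurable S -> nu.-integrable S g.
  by move=> S mS; apply: integrableS gi.
apply: (@dynkin_induction _ (measurableTypeR R) (@RGenCInfty.G R)
  (fun S => (\int[nu]_(x in S) g x = 0)%E)) => //.
- exact: RGenCInfty.measurableE.
- move=> _ _ [a ->] [b ->]; exists (Num.max a b).
  apply/seteqP; split => x /=; rewrite !in_itv/= !andbT ge_max.
    by move=> [-> ->].
  by move/andP.
- by move=> _ [a ->].
- move=> S mS S0; have := @integral_setU _ _ _ nu S (~` S) g mS (measurableC mS).
  rewrite setUv S0 add0e gT => <- //.
    exact: measurable_int gi.
  by apply/eqP; rewrite setICr.
- move=> F mF tF F0; rewrite integral_bigcup//; last first.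
    by apply: gi'; apply: bigcupT_measurable.
  by rewrite eseries0.
- by move: mE; rewrite -[X in _ -> X E]RGenCInfty.measurableE.
Qed.

Lemma Lfun2P (f : R -> R) : f \in Lfun mu 2%:E <->
  measurable_fun setT f /\ (\int[mu]_s (f s ^+ 2)%:E < +oo)%E.
Proof.
have sqrE : (\int[mu]_s (`|(f s)%:E| `^ 2) = \int[mu]_s (f s ^+ 2)%:E)%E.
  apply: eq_integral => s _.
  by rewrite abse_EFin poweR_EFin powR_mulrn// real_normK// num_real.
split=> [/andP[]|[mf fi]].
  rewrite inE/= => mf; rewrite inE/= /finite_norm unlock => fi; split => //.
  by rewrite -sqrE; apply: (@lty_poweRy _ _ 2^-1).
apply/andP; rewrite !inE/=; split => //.
by rewrite /finite_norm unlock/= sqrE; apply: poweR_lty.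
Qed.

Lemma Lfun2_bounded (f : R -> R) (c : R) : measurable_fun setT f ->
  (forall s, `|f s| <= c) -> f \in Lfun mu 2%:E.
Proof.
move=> mf fc; apply/Lfun2P; split => //.
apply: (@le_lt_trans _ _ (\int[mu]_x (cst (c ^+ 2)%:E) x)%E).
  apply: ge0_le_integral => //.
  - by move=> x _; rewrite lee_fin sqr_ge0.
  - by apply/measurable_EFinP; exact: measurable_funX.
  - move=> x _ /=; rewrite lee_fin -real_normK ?num_real//.
    by rewrite lerXn2r ?nnegrE ?(le_trans _ (fc x)).
rewrite integral_cst// lte_mul_pinfty//; first by rewrite lee_fin sqr_ge0.
rewrite /lebesgue01/= /mrestr setTI lebesgue_measure_itv/= lte_fin ltr01.
by rewrite oppr0 adde0 ltry.
Qed.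

(** For positive semidefinite [A] these are the simplest elements of the cone: paths with at most
    one jump, from 0 to [A]. *)
Definition ray_mx (a : R) (A : 'M[R]_D) : R -> 'M[R]_D :=
  fun s => (a <= s)%R%:R *: A.

Lemma ray_mx_symL2 a (A : 'M[R]_D) : A^T = A -> ray_mx a A \in @symL2_pred R D.
Proof.
move=> sA; apply/symL2P; split=> [s|i j]; first by rewrite linearZ/= sA.
apply: (@Lfun2_bounded _ `|A i j|) => [|s].
  under eq_fun do rewrite mxE.
  apply: measurable_funM => //.
  rewrite [X in measurable_fun _ X](_ : _ = \1_(`[a, +oo[%classic)).
    by apply: measurable_indic.
  by apply/funext => r; rewrite indicE mem_setE in_itv/= andbT.
by rewrite mxE normrM ler_piMl//; case: (a <= s); rewrite ?normr1 ?normr0.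
Qed.

Definition ray_fun a (A : 'M[R]_D) (sA : A^T = A) : symL2_fun R D :=
  SymL2Fun (ray_mx_symL2 a sA).

Lemma psdmx0 : psdmx (0 : 'M[R]_D).
Proof. by split=> [|v]; rewrite ?trmx0// mulmx0 mul0mx mxE. Qed.

(** The path is constant just to the right and just to the left of every point; as the ray contains
    its endpoint, the jump is right-continuous. *)
Lemma cone_ray a (A : 'M[R]_D) (sA : A^T = A) : psdmx A ->
  cone R D (\pi_(symL2 R D)%qT (ray_fun a sA)).
Proof.
move=> psdA; exists (ray_mx a A); first exact: symL2_reprE.
have psd01 (b : bool) : psdmx (b%:R *: A).
  by case: b; rewrite ?scale1r// scale0r; exact: psdmx0.
split.
- by move=> s _; rewrite /ray_mx.
- move=> s t _ _ st; rewrite /ray_mx -scalerBl.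
  case: (leP a s) => [as_|_]; last by rewrite subr0.
  by rewrite (le_trans as_ st) subrr scale0r; exact: psdmx0.
- move=> s _; apply: cvg_near_cst; rewrite /ray_mx.
  case: (leP a s) => [as_|sa]; near=> r.
    suff -> : a <= r by [].
    by rewrite (le_trans as_)//; near: r; exact: nbhs_right_ge.
  suff -> : (a <= r) = false by [].
  by apply/negbTE; rewrite -ltNge; near: r; exact: nbhs_right_lt.
- move=> s _; apply/cvg_ex; rewrite /ray_mx.
  case: (ltP a s) => [as_|sa].
    exists A; apply: cvg_near_cst; near=> r.
    have -> : a <= r by near: r; exact: nbhs_left_ge.
    by rewrite scale1r.
  exists 0; apply: cvg_near_cst; near=> r.
  have -> : (a <= r) = false.
    by apply/negbTE; rewrite -ltNge (lt_le_trans _ sa)//.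
  by rewrite scale0r.
Unshelve. all: by end_near. Qed.

Lemma psdmx_rank1 (v : 'rV[R]_D) : psdmx (v^T *m v).
Proof.
split=> [|w]; first by rewrite trmx_mul trmxK.
rewrite mulmxA -mulmxA -[v *m w^T]trmxK trmx_mul trmxK mxE big_ord1.
by rewrite [X in _ * X]mxE -expr2 sqr_ge0.
Qed.

Lemma mxtrace_rank1 (A : 'M[R]_D) (v : 'rV[R]_D) :
  \tr (A *m (v^T *m v)) = (v *m A *m v^T) 0 0.
Proof. by rewrite mulmxA mxtrace_mulC mulmxA [LHS]/mxtrace big_ord1. Qed.

Lemma quad_delta (A : 'M[R]_D) i j :
  ((delta_mx 0 i : 'rV_D) *m A *m (delta_mx 0 j : 'rV_D)^T) 0 0 = A i j.
Proof. by rewrite trmx_delta -rowE -colE !mxE. Qed.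

Lemma quad_delta2 (A : 'M[R]_D) i j (v := delta_mx 0 i + delta_mx 0 j : 'rV[R]_D) :
  (v *m A *m v^T) 0 0 = A i i + A j i + (A i j + A j j).
Proof.
have addE (M N : 'M[R]_1) : (M + N) 0 0 = M 0 0 + N 0 0 by rewrite mxE.
by rewrite /v [_^T]linearD/= mulmxDr !mulmxDl !addE !quad_delta.
Qed.

(** Testing [e] against the jumps of direction [v^T *m v] shows that the form v e(s) v^T integrates
    to 0 over every ray, hence vanishes for almost every s. Finitely many [v] determine the
    symmetric matrix e(s), so the exceptional null sets can be united. *)
Lemma cone_orthogonal_eq0 (e : H) :
  (forall y, cone R D y -> symL2_dot e y = 0) -> e = 0.
Proof.
elim/symL2_ind: e => e e0.
have quad0 (v : 'rV[R]_D) : {ae mu, forall s, (v *m e s *m v^T) 0 0 = 0}.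
  have [sA psdA] := psdmx_rank1 v.
  have eray a : \int[mu]_s \tr (e s *m ray_mx a (v^T *m v) s) = 0.
    by rewrite -(symL2_dotE e (ray_fun a sA)); apply/e0/cone_ray.
  have eintray a : mu.-integrable setT (EFin \o (fun s => \tr (e s *m ray_mx a (v^T *m v) s))).
    exact: (symL2_integrable e (ray_fun a sA)).
  have trE s : \tr (e s *m (v^T *m v)) = (v *m e s *m v^T) 0 0.
    exact: mxtrace_rank1.
  have cst_symL2 : (fun=> v^T *m v) \in @symL2_pred R D.
    apply/symL2P; split=> // i j.
    by apply: (@Lfun2_bounded _ `|(v^T *m v) i j|) => //; exact: measurable_cst.
  have gint : mu.-integrable setT (fun s => ((v *m e s *m v^T) 0 0)%:E).
    have := symL2_integrable e (SymL2Fun cst_symL2).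
    by apply: eq_integrable => // s _; rewrite /= trE.
  have rayE a s : \tr (e s *m ray_mx a (v^T *m v) s) =
      (((fun s => (v *m e s *m v^T) 0 0)) \_ `[a, +oo[) s.
    rewrite /ray_mx -scalemxAr mxtraceZ trE patchE mem_setE in_itv/= andbT.
    by case: ifP => _; rewrite ?mul1r ?mul0r.
  have gray a : (\int[mu]_(s in `[a, +oo[) ((v *m e s *m v^T) 0 0)%:E = 0)%E.
    rewrite integral_mkcond -[LHS]fineK; last first.
      rewrite -integral_mkcond; apply: integrable_fin_num => //.
      by apply: integrableS gint.
    congr (_%:E); rewrite -(eray a); congr fine; apply: eq_integral => s _.
    by rewrite rayE restrict_EFin.
  (* The measure does not charge the complement of [0,1), so the total integral is the integral over
     the ray from 0. *)
  have gT : (\int[mu]_s ((v *m e s *m v^T) 0 0)%:E = 0)%E.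
    rewrite -(gray 0) [in RHS]integral_mkcond; apply: ae_eq_integral => //.
    - exact: measurable_int gint.
    - apply/(measurable_restrictT _ _).1 => //.
      by apply: measurable_funS (measurable_int _ gint).
    - exists (~` `[0, 1[%classic); split.
      + by apply: measurableC.
      + by rewrite /lebesgue01/= /mrestr setICl measure0.
      + move=> s /= h s01; apply: h => _; rewrite patchE mem_set//=.
        by move: s01; rewrite /= !in_itv/= andbT => /andP[].
  have := integral_rays_eq0 gint gT gray.
  by apply: filterS => s /(_ I) [].
have -> : 0 = \pi_(symL2 R D)%qT 0 :> H by rewrite !piE.
apply/eq_symL2P.
(* The forms at two basis vectors and at their sum leave only the sum of the entries (i,j) and
   (j,i), which are equal. *)
have entry0 i j : {ae mu, forall s, e s i j = 0}.
  apply: (filterS3 _ _ (quad0 (delta_mx 0 i)) (quad0 (delta_mx 0 j))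
    (quad0 (delta_mx 0 i + delta_mx 0 j))) => s.
  rewrite quad_delta2 !quad_delta => -> ->.
  have <- : e s i j = e s j i by rewrite -[in RHS](symL2_sym e s) mxE.
  by rewrite add0r addr0 => h; lra.
have : {ae mu, forall s, forall i j, e s i j = 0}.
  by apply: filter_forall => i; apply: filter_forall => j; exact: entry0.
by apply: filterS => s es; apply/matrixP => i j; rewrite es mxE.
Qed.

End Orthogonality.

(** * Completeness and closedness of the cone *)

Section Completeness.
Variables (R : realType) (D : nat).
Local Notation mu := (lebesgue01 R).
Local Notation H := (symL2 R D).

Lemma geo_sum_le2 (n : nat) : \sum_(k < n) (2^-1 : R) ^+ k <= 2.
Proof.
suff -> : \sum_(k < n) (2^-1 : R) ^+ k = 2 - 2 * 2^-1 ^+ n.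
  by rewrite gerBl// mulr_ge0// exprn_ge0// invr_ge0.
elim: n => [|n IH]; first by rewrite big_ord0 expr0; ring.
by rewrite big_ord_recr/= IH exprS; field.
Qed.

(** An increment d is at most 2^-k + 2^k d^2 in absolute value, since x <= 1 + x^2 for x = 2^k |d|;
    the increments are thus absolutely summable. Bounding squares of increments suits L^2 data. *)
Lemma weighted_square_sum_cvg (a : R^nat) (C : R) :
  (forall n, \sum_(0 <= k < n)
     (2^-1 ^+ k + 2 ^+ k * (a k.+1 - a k) ^+ 2) <= C) -> cvgn a.
Proof.
move=> aC; pose r k := 2^-1 ^+ k + 2 ^+ k * (a k.+1 - a k) ^+ 2.
have r0 k : 0 <= r k.
  apply: addr_ge0; first by rewrite exprn_ge0// invr_ge0.
  by apply: mulr_ge0; [exact: exprn_ge0|exact: sqr_ge0].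
have rcvg : cvgn (series r).
  apply: nondecreasing_is_cvgn; last by exists C => _ [n _ <-]; exact: aC.
  by apply/nondecreasing_seqP => n; rewrite seriesSr lerDl.
have dcvg : cvgn (series (telescope a)).
  apply: normed_cvg; apply: (series_le_cvg _ r0 _ rcvg) => k; rewrite /telescope//=.
  set d := a k.+1 - a k; rewrite /r -/d.
  have q0 : 0 < (2 : R) ^+ k by rewrite exprn_gt0.
  have qE : (2^-1 : R) ^+ k = (2 ^+ k)^-1 by rewrite exprVn.
  rewrite qE; set q := (2 : R) ^+ k in q0 *.
  have -> : q^-1 + q * d ^+ 2 = q^-1 * (1 + (q * `|d|) ^+ 2).
    by rewrite exprMn real_normK ?num_real//; field; rewrite gt_eqF.
  rewrite mulrC -ler_pdivrMr ?invr_gt0// invrK.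
  have := sqr_ge0 (q * `|d| - 1); rewrite sqrrB expr1n mulr1.
  have qd : 0 <= q * `|d| by rewrite mulr_ge0// ltW.
  rewrite mulrC; lra.
rewrite (_ : a = cst (a 0) + series (telescope a)); last first.
  by apply/funext => n; rewrite [LHS](eq_sum_telescope a n).
by apply/cvg_ex; eexists; apply: (cvgD (cvg_cst (a 0)) dcvg).
Qed.

(** The squared Frobenius norm, equal to the trace of M M when [M] is symmetric. *)
Definition mxsq (M : 'M[R]_D) : R := \sum_i \sum_j M i j ^+ 2.

Lemma mxsq_ge0 M : 0 <= mxsq M.
Proof. by do 2!apply: sumr_ge0 => ? _; exact: sqr_ge0. Qed.

Lemma sqr_le_mxsq (M : 'M[R]_D) i j : M i j ^+ 2 <= mxsq M.
Proof.
rewrite /mxsq (bigD1 i)//= (bigD1 j)//= -addrA lerDl addr_ge0//.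
  by apply: sumr_ge0 => ? _; exact: sqr_ge0.
by do 2!apply: sumr_ge0 => ? _; exact: sqr_ge0.
Qed.

Lemma mxsq0 : mxsq 0 = 0.
Proof.
by rewrite /mxsq big1// => i _; rewrite big1// => j _; rewrite mxE expr0n.
Qed.

Lemma measurable_mxsq (f : R -> 'M[R]_D) :
  (forall i j, measurable_fun setT (fun s => f s i j)) ->
  measurable_fun setT (fun s => mxsq (f s)).
Proof.
move=> mf; apply: measurable_sum => i; apply: measurable_sum => j.
exact: measurable_funX.
Qed.

Lemma measurable_symL2_fun (f : symL2_fun R D) i j :
  measurable_fun setT (fun s => f s i j).
Proof. by have /Lfun2P[] := symL2_Lfun f i j. Qed.

Lemma integral_mxsq (f : symL2_fun R D) :
  (\int[mu]_s (mxsq (f s))%:E)%E = (`|\pi_(symL2 R D)%qT f : H| ^+ 2)%:E.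
Proof.
rewrite symL2_normE sqr_sqrtr ?symL2_dot_ge0// symL2_dotE -[LHS]fineK.
  congr (_%:E); congr fine; apply: eq_integral => s _.
  by rewrite mxtrace_sym// symL2_sym.
rewrite (_ : (fun s => _) = EFin \o (fun s => \tr (f s *m f s))); last first.
  by apply/funext => s /=; rewrite mxtrace_sym// symL2_sym.
exact: integrable_fin_num (symL2_integrable f f).
Qed.

Lemma integral_mxsqB (f g : symL2_fun R D) :
  (\int[mu]_s (mxsq (f s - g s))%:E)%E =
  (`|\pi_(symL2 R D)%qT f - \pi_(symL2 R D)%qT g : H| ^+ 2)%:E.
Proof.
have -> : \pi_(symL2 R D)%qT f - \pi_(symL2 R D)%qT g = \pi_(symL2 R D)%qT (f - g) :> H.
  by rewrite !piE.
exact: integral_mxsq (f - g).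
Qed.

Lemma geometric_dist (V : normedModType R) (x : nat -> V) :
  (forall n, `|x n.+1 - x n| <= 2^-1 ^+ n) ->
  forall n m, (n <= m)%N -> `|x n - x m| <= 2 * 2^-1 ^+ n.
Proof.
move=> xS n m /subnKC <-; move: (m - n)%N => {m} k.
apply: (@le_trans _ _ (2^-1 ^+ n * \sum_(j < k) 2^-1 ^+ j)); last first.
  by rewrite mulrC ler_wpM2r ?geo_sum_le2// exprn_ge0// invr_ge0.
elim: k => [|k IH]; first by rewrite addn0 subrr normr0 big_ord0 mulr0.
rewrite addnS big_ord_recr/= mulrDr -exprD.
rewrite (le_trans (ler_distD (x (n + k)%N) _ _))// lerD//.
by rewrite distrC.
Qed.

(** The Riesz-Fischer argument: a weighted sum of squared increments is integrable, hence finite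
    almost everywhere, and the entries converge where it is finite; Fatou's lemma gives the norm
    bound. The pointwise limit is recorded because the order properties of the cone pass to the
    limit pointwise. *)
Lemma symL2_complete (x : nat -> H) :
  (forall n, `|x n.+1 - x n| <= 2^-1 ^+ n) ->
  exists l : H, (forall n, `|x n - l| <= 2 * 2^-1 ^+ n) /\
    {ae mu, forall s, forall i j, (fun n => x n s i j) @ \oo --> l s i j}.
Proof.
move=> xS; pose f n : symL2_fun R D := repr (x n).
have pif n : \pi_(symL2 R D)%qT (f n) = x n by rewrite reprK.
pose r n s := 2^-1 ^+ n + 2 ^+ n * mxsq (f n.+1 s - f n s).
have q0 n : 0 <= (2^-1 : R) ^+ n by rewrite exprn_ge0// invr_ge0.
have q0' n : 0 <= (2 : R) ^+ n by rewrite exprn_ge0.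
have r0 n s : 0 <= r n s by rewrite addr_ge0// mulr_ge0// mxsq_ge0.
have msq n m : measurable_fun setT (fun s => mxsq (f n s - f m s)).
  apply: measurable_mxsq => i j; under eq_fun do rewrite !mxE.
  by apply: measurable_funB; exact: measurable_symL2_fun.
have mr n : measurable_fun setT (EFin \o r n).
  apply/measurable_EFinP; apply: measurable_funD; first exact: measurable_cst.
  by apply: measurable_funM; [exact: measurable_cst|exact: msq].
pose S s := (\sum_(0 <= n <oo) (r n s)%:E)%E.
have mS : measurable_fun setT S.
  by apply: ge0_emeasurable_sum => [n s _ _|n _]; [rewrite lee_fin|exact: mr].
have S0 s : (0 <= S s)%E by apply: nneseries_ge0 => n _ _; rewrite lee_fin.
have mu1 : (mu setT <= 1)%E.
  rewrite /lebesgue01/= /mrestr setTI lebesgue_measure_itv/= lte_fin ltr01.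
  by rewrite oppr0 adde0.
(* The constant term contributes 2^-n, and the squared increment at most 2^n (2^-n)^2 = 2^-n. *)
have intr n : (\int[mu]_s (r n s)%:E <= (2 * 2^-1 ^+ n)%:E)%E.
  rewrite /r; under eq_integral do rewrite EFinD EFinM.
  rewrite ge0_integralD//; last 2 first.
  - by move=> s _; rewrite -EFinM lee_fin mulr_ge0// mxsq_ge0.
  - apply: emeasurable_funM; first exact: measurable_cst.
    by apply/measurable_EFinP; exact: msq.
  rewrite integral_cst// ge0_integralZl_EFin//; last 2 first.
  - by move=> s _; rewrite lee_fin mxsq_ge0.
  - by apply/measurable_EFinP; exact: msq.
  rewrite integral_mxsqB !pif mulrDl mul1r EFinD leeD//.
    by rewrite -[leRHS]mule1 lee_pmul2l// lte_fin exprn_gt0// invr_gt0.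
  rewrite -EFinM lee_fin.
  apply: (@le_trans _ _ (2 ^+ n * (2^-1 ^+ n) ^+ 2)).
    by rewrite ler_wpM2l// lerXn2r ?nnegrE.
  by rewrite expr2 mulrA -exprMn divff// expr1n mul1r.
have intS : (\int[mu]_s S s <= 4%:E)%E.
  rewrite integral_nneseries//; last by move=> n s _; rewrite lee_fin.
  apply: lime_le.
    by apply: is_cvg_nneseries => n _ _; apply: integral_ge0 => s _; rewrite lee_fin.
  apply: nearW => n; apply: (@le_trans _ _ (\sum_(0 <= k < n) (2 * 2^-1 ^+ k)%:E)%E).
    by apply: lee_sum => k _; exact: intr.
  rewrite sumEFin lee_fin -mulr_sumr big_mkord.
  by have := geo_sum_le2 n; lra.
have Sfin : {ae mu, forall s, (S s < +oo)%E}.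
  have /integrable_ae : mu.-integrable setT S.
    apply/integrableP; split => //; rewrite (le_lt_trans _ (ltry 4))//.
    by under eq_integral do rewrite gee0_abs//.
  move=> /(_ measurableT); apply: filterS => s /(_ I).
  by rewrite ge0_fin_numE.
pose E := [set s : R | (S s < +oo)%E].
have mE : measurable E.
  by rewrite -[E]setTI; exact: (emeasurable_fun_infty_o measurableT mS).
(* Setting the functions to 0 off [E] makes them converge everywhere, so that the limit is
   measurable. *)
pose g n (s : R) : 'M[R]_D := if s \in E then f n s else 0.
have gcvg s i j : cvgn (fun n => g n s i j).
  have [sE|sE] := boolP (s \in E); last first.
    by rewrite /g (negbTE sE); exact: is_cvg_cst.
  rewrite /g sE; move/set_mem : sE => sE.
  apply: (@weighted_square_sum_cvg _ (fine (S s))) => n.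
  apply: (@le_trans _ _ (\sum_(0 <= k < n) r k s)).
    apply: ler_sum => k _; rewrite /r lerD2l ler_wpM2l//.
    by have := sqr_le_mxsq (f k.+1 s - f k s) i j; rewrite !mxE.
  rewrite -lee_fin fineK ?ge0_fin_numE// -sumEFin.
  by apply: nneseries_lim_ge => k _ _; rewrite lee_fin.
pose l0 (s : R) : 'M[R]_D := \matrix_(i, j) limn (fun n => g n s i j).
have gl s i j : (fun n => g n s i j) @ \oo --> l0 s i j by rewrite mxE; exact: gcvg.
have mg n i j : measurable_fun setT (fun s => g n s i j).
  rewrite (_ : (fun s => _) = (fun s => f n s i j) \_ E).
    apply/(measurable_restrictT _ _).1 => //.
    by apply: measurable_funS (measurable_symL2_fun _ _ _).
  by apply/funext => s; rewrite patchE /g; case: ifP => //; rewrite mxE.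
have ml i j : measurable_fun setT (fun s => l0 s i j).
  by apply: (measurable_fun_cvg (fun n => mg n i j)) => s _; exact: gl.
have mxsqB n m : measurable_fun setT (EFin \o (fun s => mxsq (g n s - g m s))).
  apply/measurable_EFinP; apply: measurable_mxsq => i j.
  by under eq_fun do rewrite !mxE; apply: measurable_funB.
have mgl n i j : measurable_fun setT (fun s => (g n s - l0 s) i j).
  rewrite (_ : (fun s => _) = (fun s => g n s i j - l0 s i j)).
    by apply: measurable_funB; [exact: mg|exact: ml].
  by apply/funext => s; rewrite !mxE.
(* Fatou's lemma in m with n fixed; the distance from [x n] to [x m] is at most 2 * 2^-n as soon as
   m >= n. *)
have dist n : (\int[mu]_s (mxsq (g n s - l0 s))%:E <= ((2 * 2^-1 ^+ n) ^+ 2)%:E)%E.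
  have -> : (\int[mu]_s (mxsq (g n s - l0 s))%:E =
      \int[mu]_s limn_einf (fun m => (mxsq (g n s - g m s))%:E))%E.
    apply: eq_integral => s _; apply/esym.
    suff sqcvg : (fun m => (mxsq (g n s - g m s))%:E) @ \oo --> (mxsq (g n s - l0 s))%:E.
      by rewrite (cvg_limn_einf_sup sqcvg).
    have sqcvg : mxsq (g n s - g m s) @[m --> \oo] --> mxsq (g n s - l0 s).
      apply: cvg_big => [|i _]; first exact: add_continuous.
      apply: cvg_big => [|j _]; first exact: add_continuous.
      rewrite !mxE !expr2.
      have sub : (fun m => (g n s - g m s) i j) @ \oo --> g n s i j - l0 s i j.
        under eq_fun do rewrite !mxE.
        by apply: cvgB; [exact: cvg_cst|exact: gl].
      by rewrite mxE in sub; under eq_fun do rewrite expr2; apply: cvgM.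
    by apply: cvg_EFin sqcvg; exact: nearW.
  apply: le_trans (fatou _ _ _ _) _ => //.
  - by move=> m; exact: mxsqB.
  - by move=> m s _; rewrite lee_fin mxsq_ge0.
  rewrite limn_einf_lim; apply: lime_le; first exact: is_cvg_einfs.
  near=> m; apply: (@le_trans _ _ (\int[mu]_s (mxsq (g n s - g m s))%:E)%E).
    by apply: ereal_inf_lbound; exists m => //=; exact: leqnn.
  apply: (@le_trans _ _ (\int[mu]_s (mxsq (f n s - f m s))%:E)%E).
    apply: ge0_le_integral => //.
    - by move=> s _; rewrite lee_fin mxsq_ge0.
    - exact: mxsqB.
    - by apply/measurable_EFinP; exact: msq.
    - move=> s _; rewrite lee_fin /g; case: ifP => // _.
      by rewrite subrr mxsq0 mxsq_ge0.
  rewrite integral_mxsqB !pif lee_fin lerXn2r ?nnegrE ?mulr_ge0//.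
  by apply: geometric_dist => //; near: m; exact: nbhs_infty_ge.
have l0P : l0 \in @symL2_pred R D.
  apply/symL2P; split=> [s|i j].
    apply/matrixP => i j; rewrite !mxE; congr (limn _); apply/funext => n.
    by rewrite /g; case: ifP => _; rewrite ?mxE// -[in RHS](symL2_sym (f n) s) mxE.
  have [L0 LD] := Lfun_submod_closed mu (lee1n 2).
  (* The limit is square-integrable because [g 0] is, being dominated by [f 0], and because its
     distance to [g 0] is finite. *)
  rewrite [X in X \in _](_ : _ = -1 *: (fun s => g 0 s i j - l0 s i j) + (fun s => g 0 s i j)).
    apply: LD; apply/Lfun2P; split => //.
    - exact: measurable_funB.
    - apply: le_lt_trans (ltry ((2 * 2^-1 ^+ 0) ^+ 2)).
      apply: le_trans (dist 0); apply: ge0_le_integral => //.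
      + by move=> s _; rewrite lee_fin sqr_ge0.
      + apply/measurable_EFinP; apply: measurable_funX.
        by apply: measurable_funB; [exact: mg|exact: ml].
      + by apply/measurable_EFinP; apply: measurable_mxsq => i' j'; exact: mgl.
      + move=> s _; rewrite lee_fin.
        by have := sqr_le_mxsq (g 0 s - l0 s) i j; rewrite !mxE.
    - have /Lfun2P[_] := symL2_Lfun (f 0) i j; apply: le_lt_trans.
      apply: ge0_le_integral => //.
      + by move=> s _; rewrite lee_fin sqr_ge0.
      + by apply/measurable_EFinP; apply: measurable_funX; exact: mg.
      + apply/measurable_EFinP; apply: measurable_funX.
        exact: measurable_symL2_fun.
      + move=> s _; rewrite lee_fin /g; case: ifP => // _.
        by rewrite mxE expr0n sqr_ge0.
  apply/funext => s; rewrite /= -[RHS]/(-1 * (g 0 s i j - l0 s i j) + g 0 s i j).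
  by ring.
pose l1 := SymL2Fun l0P.
exists (\pi_(symL2 R D)%qT l1); split=> [n|].
  rewrite -ler_sqr ?nnegrE ?mulr_ge0// -lee_fin -pif -integral_mxsqB.
  apply: le_trans (dist n); rewrite le_eqVlt; apply/orP; left; apply/eqP.
  apply: ae_eq_integral => //.
  - apply/measurable_EFinP; apply: measurable_mxsq => i j.
    rewrite (_ : (fun s => _) = (fun s => f n s i j - l0 s i j)).
      by apply: measurable_funB; [exact: measurable_symL2_fun|exact: ml].
    by apply/funext => s; rewrite !mxE.
  - by apply/measurable_EFinP; apply: measurable_mxsq => i j; exact: mgl.
  - by apply: filterS Sfin => s sE _; rewrite /g mem_set.
apply: (filterS2 _ _ Sfin (symL2_reprE l1)) => s sE -> i j.
rewrite [X in X @ _ --> _](_ : _ = (fun n => g n s i j)); first exact: gl.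
by apply/funext => n; rewrite /g mem_set.
Unshelve. all: by end_near. Qed.

End Completeness.

(** * Right-continuous regularization of an increasing function given on a dense set *)

Section RightRegularization.
Variables (R : realType) (E : set R).
Hypothesis E01 : forall s, E s -> 0 <= s < 1.
Hypothesis Edense : forall a b, 0 <= a -> a < b -> b <= 1 ->
  exists2 r, E r & a < r < b.

(** The inequality [s < r] is strict: dropping the value at [s] is what makes the result
    right-continuous. *)
Definition right_inf (q : R -> R) (s : R) : R :=
  inf (q @` [set r | E r /\ s < r]).

(** By density, [E] accumulates at [s] from the right, so that limits from the right along [E] are
    unique. *)
Lemma within_right_proper s : 0 <= s < 1 -> ProperFilter (within E s^'+).
Proof.
move=> /andP[s0 s1]; apply: Build_ProperFilter; rewrite /within/= => -[d /= d0 dP].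
have sm : s < Num.min (s + d) 1 by rewrite lt_min s1 andbT ltrDl.
have m1 : Num.min (s + d) 1 <= 1 by rewrite ge_min lexx orbT.
have [r Er /andP[sr rd]] := Edense s0 sm m1.
apply: (dP r) => //=.
by rewrite distrC gtr0_norm ?subr_gt0// ltrBlDl (lt_le_trans rd)// ge_min lexx.
Qed.

Variable q : R -> R.
Hypothesis qmono : forall r t, E r -> E t -> r <= t -> q r <= q t.
Hypothesis q0 : forall r, E r -> 0 <= q r.

Local Notation qr := (right_inf q).

Lemma right_inf_has_inf s : 0 <= s < 1 -> has_inf (q @` [set r | E r /\ s < r]).
Proof.
move=> /andP[s0 s1]; split.
  by have [r Er /andP[sr _]] := Edense s0 s1 (lexx 1); exists (q r), r.
by exists 0 => _ [r [Er _] <-]; exact: q0.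
Qed.

Lemma right_inf_le s r : 0 <= s < 1 -> E r -> s < r -> qr s <= q r.
Proof.
by move=> s01 Er sr; apply: ge_inf; [exact: (right_inf_has_inf s01).2|exists r].
Qed.

Lemma le_right_inf s c : 0 <= s < 1 ->
  (forall r, E r -> s < r -> c <= q r) -> c <= qr s.
Proof.
move=> s01 cq; apply: lb_le_inf; first exact: (right_inf_has_inf s01).1.
by move=> _ [r [Er sr] <-]; exact: cq.
Qed.

Lemma right_inf_ge0 s : 0 <= s < 1 -> 0 <= qr s.
Proof. by move=> s01; apply: le_right_inf => // r Er _; exact: q0. Qed.

Lemma right_inf_mono s t : 0 <= s < 1 -> 0 <= t < 1 -> s <= t -> qr s <= qr t.
Proof.
move=> s01 t01 st; apply: le_right_inf => // r Er tr.
by apply: right_inf_le => //; exact: le_lt_trans tr.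
Qed.

Lemma right_inf_ge s : E s -> q s <= qr s.
Proof.
by move=> Es; apply: le_right_inf (E01 Es) _ => r Er /ltW sr; exact: qmono.
Qed.

Lemma right_inf_adherent s e : 0 <= s < 1 -> 0 < e ->
  exists r, [/\ E r, s < r & q r < qr s + e].
Proof.
move=> s01 e0; have [_ [r [Er sr] <-] qre] := inf_adherent e0 (right_inf_has_inf s01).
by exists r.
Qed.

Lemma cvg_right_inf s : 0 <= s < 1 -> q r @[r --> within E s^'+] --> qr s.
Proof.
move=> s01; apply/cvgrPdist_lt => e e0.
have [r0 [Er0 sr0 qr0]] := right_inf_adherent s01 e0.
rewrite near_withinE; near=> r => Er.
have sr : s < r by near: r; exact: nbhs_right_gt.
have rr0 : r <= r0 by near: r; exact: nbhs_right_le.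
rewrite distrC ger0_norm ?subr_ge0 ?right_inf_le//.
by rewrite ltrBlDl (le_lt_trans _ qr0)// qmono.
Unshelve. all: by end_near. Qed.

Lemma right_inf_right_cont s : 0 <= s < 1 -> qr r @[r --> s^'+] --> qr s.
Proof.
move=> s01; apply/cvgrPdist_lt => e e0.
have [r0 [Er0 sr0 qr0]] := right_inf_adherent s01 e0.
near=> r.
have sr : s < r by near: r; exact: nbhs_right_gt.
have rr0 : r < r0 by near: r; exact: nbhs_right_lt.
have r01 : 0 <= r < 1.
  have /andP[s0 _] := s01; have /andP[_ r1] := E01 Er0.
  by rewrite (le_trans s0 (ltW sr)) (lt_trans rr0 r1).
rewrite distrC ger0_norm ?subr_ge0 ?right_inf_mono ?(ltW sr)//.
by rewrite ltrBlDl (le_lt_trans _ qr0)// right_inf_le.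
Unshelve. all: by end_near. Qed.

(** On the left of [s] the regularization is increasing and bounded by its value at [s]. *)
Lemma right_inf_left_cvg s : 0 < s < 1 -> cvg (qr r @[r --> s^'-]).
Proof.
move=> /andP[s0 s1]; have s01 : 0 <= s < 1 by rewrite (ltW s0).
have in01 x r : 0 <= x -> r \in `]x, s[ -> 0 <= r < 1.
  move=> x0; rewrite in_itv/= => /andP[xr rs].
  by rewrite (le_trans x0 (ltW xr)) (lt_trans rs s1).
apply: nondecreasing_at_left_is_cvgr; near=> x.
  have x0 : 0 <= x by near: x; exact: nbhs_left_ge.
  by move=> r t rI tI; apply: right_inf_mono; apply: in01 x0 _.
have x0 : 0 <= x by near: x; exact: nbhs_left_ge.
exists (qr s) => _ [r rI <-]; apply: right_inf_mono (in01 _ _ x0 rI) s01 _.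
by move: rI; rewrite /= in_itv/= => /andP[_ /ltW].
Unshelve. all: by end_near. Qed.

(* The open gaps ]q s, qr s[ are pairwise disjoint and each contains a rational. *)
Lemma countable_right_inf_gap : countable [set s | E s /\ q s < qr s].
Proof.
pose f s := if pselect (exists z : rat, q s < ratr z < qr s) is left h
  then pickle (projT1 (cid h)) else 0%N.
apply/countable_injP; exists f => s t /set_mem[Es qs] /set_mem[Et qt].
have gap r : q r < qr r -> exists z : rat, q r < ratr z < qr r.
  by move=> /rat_in_itvoo[z]; rewrite in_itv/= => ?; exists z.
rewrite /f; case: pselect => [hs|/(_ (gap _ qs))//].
case: pselect => [ht|/(_ (gap _ qt))//].
case: (cid hs) => /= zs /andP[zs1 zs2]; case: (cid ht) => /= zt /andP[zt1 zt2].
move=> /(pcan_inj pickleK) zst; subst zt.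
apply/eqP; rewrite eq_le !leNgt; apply/andP; split; apply/negP => st.
  have := right_inf_le (E01 Et) Es st.
  by rewrite leNgt (lt_trans zs1 zt2).
have := right_inf_le (E01 Es) Et st.
by rewrite leNgt (lt_trans zt1 zs2).
Qed.

End RightRegularization.

(** * Quadratic forms and polarization *)

Section QuadraticForms.
Variables (R : realType) (D : nat).

Definition quad (v : 'rV[R]_D) (A : 'M[R]_D) : R := (v *m A *m v^T) 0 0.

Lemma quadB v A B : quad v (A - B) = quad v A - quad v B.
Proof. by rewrite /quad mulmxBr mulmxBl !mxE. Qed.

Lemma cvg_quad (T : Type) (F : set_system T) (FF : Filter F)
    (f : T -> 'M[R]_D) (A : 'M[R]_D) v :
  (forall i j, f x i j @[x --> F] --> A i j) -> quad v (f x) @[x --> F] --> quad v A.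
Proof.
move=> fA; rewrite /quad.
have quadE B : (v *m B *m v^T) 0 0 = \sum_j (\sum_i v 0 i * B i j) * v 0 j.
  by rewrite mxE; apply: eq_bigr => j _; rewrite !mxE.
rewrite quadE; under eq_fun do rewrite quadE.
apply: cvg_big => [|j _]; first exact: add_continuous.
apply: cvgM; last exact: cvg_cst.
apply: cvg_big => [|i _]; first exact: add_continuous.
by apply: cvgM; [exact: cvg_cst|exact: fA].
Qed.

(** Carries results on the scalar forms, to which monotonicity arguments apply, over to the
    entries. *)
Lemma polarization (A : 'M[R]_D) i j : A^T = A ->
  A i j = 2^-1 * (quad (delta_mx 0 i + delta_mx 0 j) A
                  - quad (delta_mx 0 i) A - quad (delta_mx 0 j) A).
Proof.
move=> sA; rewrite /quad quad_delta2 !quad_delta.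
have -> : A j i = A i j by rewrite -[in RHS]sA mxE.
by field.
Qed.

Lemma cvg_mx_entries (T : Type) (F : set_system T) (FF : Filter F)
    (f : T -> 'M[R]_D) (A : 'M[R]_D) :
  (forall i j, f x i j @[x --> F] --> A i j) -> f x @[x --> F] --> A.
Proof.
move=> fA P [Q nQ QP].
have : \forall x \near F, forall i j, Q i j (f x i j).
  by apply: filter_forall => i; apply: filter_forall => j; apply: fA; exact: nQ.
by apply: filterS => x /QP.
Qed.

End QuadraticForms.

(** * Closedness of the cone under almost everywhere limits *)

Section ConeClosed.
Variables (R : realType) (D : nat).
Local Notation mu := (lebesgue01 R).
Local Notation H := (symL2 R D).

Lemma ae_lebesgue01_itv : {ae mu, forall s, 0 <= s < 1}.
Proof.
exists (~` `[0, 1[%classic); split.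
- by apply: measurableC.
- by rewrite /lebesgue01/= /mrestr setICl measure0.
- by move=> s /= h; rewrite in_itv.
Qed.

(** A nonempty open subinterval of [0,1] has positive measure and cannot lie in the exceptional null
    set. *)
Lemma ae_lebesgue01_dense (P : set R) : {ae mu, forall s, P s} ->
  forall a b, 0 <= a -> a < b -> b <= 1 -> exists2 r, P r & a < r < b.
Proof.
move=> [N [mN muN PN]] a b a0 ab b1; apply/not_exists2P => noP.
have abN : `]a, b[%classic `<=` N.
  move=> r; rewrite /= in_itv/= => arb; apply: PN => /= Pr.
  by case: (noP r).
have : (mu `]a, b[%classic <= 0)%E by rewrite -muN le_measure// inE.
rewrite /lebesgue01/= /mrestr setIidl; last first.
  move=> r; rewrite /= !in_itv/= => /andP[ar rb].
  by rewrite (le_trans a0 (ltW ar)) (lt_le_trans rb b1).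
by rewrite lebesgue_measure_itv/= lte_fin ab -EFinD lee_fin leNgt subr_gt0 ab.
Qed.

(* The limit is increasing only on a set E of full measure.  Taking infima to the
   right of the forms v l(s) v^T changes them at countably many points and gives
   a cadlag representative, recovered from the forms by polarization. *)
Lemma cone_closed (x : nat -> H) (l : H) : (forall n, cone R D (x n)) ->
  {ae mu, forall s, forall i j, (fun n => x n s i j) @ \oo --> l s i j} ->
  cone R D l.
Proof.
move=> xcone xl.
(* Only positivity and monotonicity of the representatives are kept: one-sided limits do not survive
   pointwise convergence and are rebuilt below. *)
have /choice[m mP] : forall n, exists m : R -> 'M[R]_D,
    {ae mu, forall s, x n s = m s} /\
    [/\ forall s, s \in `[0, 1[ -> psdmx (m s) &
      forall s t, s \in `[0, 1[ -> t \in `[0, 1[ -> s <= t -> psdmx (m t - m s)].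
  by move=> n; have [m xm [m1 m2 _ _]] := xcone n; exists m.
pose E := [set s : R | [/\ 0 <= s < 1, forall n, x n s = m n s &
  forall i j, (fun n => x n s i j) @ \oo --> l s i j]].
have aeE : {ae mu, forall s, E s}.
  have xm : {ae mu, forall s, forall n, x n s = m n s}.
    by apply/ae_foralln => n; case: (mP n).
  by apply: (filterS3 _ _ ae_lebesgue01_itv xm xl).
have E01 s : E s -> 0 <= s < 1 by case.
have Edense := ae_lebesgue01_dense aeE.
have lsym s : (l s)^T = l s by exact: symL2_sym.
have quadcvg s v : E s -> quad v (m n s) @[n --> \oo] --> quad v (l s).
  move=> [_ xms xls]; apply: cvg_quad => i j.
  by under eq_fun do rewrite -xms; exact: xls.
have E01' s : E s -> s \in `[0, 1[ by move=> /E01; rewrite in_itv.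
have q0 v s : E s -> 0 <= quad v (l s).
  move=> Es; apply: (cvgr_to_ge (quadcvg s v Es)).
  by apply: nearW => n; have [_ [/(_ _ (E01' _ Es))[_ +] _]] := mP n; exact.
have qmono v s t : E s -> E t -> s <= t -> quad v (l s) <= quad v (l t).
  move=> Es Et st; apply: (ler_cvg_to (quadcvg s v Es) (quadcvg t v Et)).
  apply: nearW => n; have [_ [_ /(_ _ _ (E01' _ Es) (E01' _ Et) st)[_ psd]]] := mP n.
  by rewrite -subr_ge0 -quadB; exact: psd.
pose qr v := right_inf E (fun s => quad v (l s)).
pose M (s : R) : 'M[R]_D := \matrix_(i, j) (2^-1 *
  (qr (delta_mx 0 i + delta_mx 0 j) s - qr (delta_mx 0 i) s - qr (delta_mx 0 j) s)).
have Msym s : (M s)^T = M s.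
  apply/matrixP => i j; rewrite !mxE; congr (_ * _).
  by rewrite [X in qr X]addrC addrAC.
have cvgq s v : 0 <= s < 1 ->
    quad v (l r) @[r --> within E s^'+] --> qr v s.
  by move=> s01; exact: (cvg_right_inf Edense (qmono v) (q0 v)).
have cvgM_ s : 0 <= s < 1 -> forall i j, l r i j @[r --> within E s^'+] --> M s i j.
  move=> s01 i j; rewrite mxE; under eq_fun do rewrite (polarization _ _ (lsym _)).
  apply: cvgM; first exact: cvg_cst.
  by apply: cvgB; [apply: cvgB|]; exact: cvgq.
(* The infima are taken one vector at a time, so [qr v s] is not visibly a quadratic form in [v]. It
   is the form of [M s], as both are the limit of [quad v (l r)] when [r] tends to [s] from the
   right in [E]. *)
have quadM s v : 0 <= s < 1 -> quad v (M s) = qr v s.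
  move=> s01; have := within_right_proper Edense s01 => PF.
  have lM : quad v (l r) @[r --> within E s^'+] --> quad v (M s).
    by apply: cvg_quad; exact: cvgM_.
  exact: (cvg_unique (@Rhausdorff R) lM (cvgq s v s01)).
exists M; last first.
  split.
  - move=> s; rewrite in_itv/= => s01; split=> // v.
    by rewrite -/(quad v (M s)) quadM//; exact: (right_inf_ge0 Edense (q0 v)).
  - move=> s t; rewrite !in_itv/= => s01 t01 st; split=> [|v].
      by rewrite linearB/= !Msym.
    rewrite -/(quad v (M t - M s)) quadB !quadM// subr_ge0.
    exact: (right_inf_mono Edense (q0 v)).
  - move=> s; rewrite in_itv/= => s01.
    have qc v : qr v r @[r --> s^'+] --> qr v s.
      exact: (right_inf_right_cont E01 Edense (q0 v) s01).
    apply: cvg_mx_entries => i j.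
    rewrite mxE; under eq_fun do rewrite mxE.
    apply: cvgM; first exact: cvg_cst.
    by apply: cvgB; [apply: cvgB|]; exact: qc.
  - move=> s; rewrite in_itv/= => s01.
    have qc v : cvg (qr v r @[r --> s^'-]).
      exact: (right_inf_left_cvg Edense (q0 v) s01).
    apply/cvg_ex; exists (\matrix_(i, j) (2^-1 *
      (lim (qr (delta_mx 0 i + delta_mx 0 j) r @[r --> s^'-])
       - lim (qr (delta_mx 0 i) r @[r --> s^'-])
       - lim (qr (delta_mx 0 j) r @[r --> s^'-])))).
    apply: cvg_mx_entries => i j; rewrite mxE; under eq_fun do rewrite mxE.
    apply: cvgM; first exact: cvg_cst.
    by apply: cvgB; [apply: cvgB|]; exact: qc.
have gap v : {ae mu, forall s, E s -> quad v (l s) = qr v s}.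
  pose G := [set s | E s /\ quad v (l s) < qr v s].
  have cG : countable G by exact: (countable_right_inf_gap E01 Edense (q0 v)).
  have mG : measurable (G : set (measurableTypeR R)) by apply: countable_measurable.
  exists G; split => //.
    apply/eqP; rewrite eq_le measure_ge0 andbT.
    rewrite -(countable_lebesgue_measure0 cG) /lebesgue01/= /mrestr.
    by rewrite le_measure// ?inE//; apply: measurableI.
  move=> s /= /not_implyP[Es /eqP qne]; split => //.
  by rewrite lt_neqAle qne (right_inf_ge E01 Edense (qmono v) (q0 v)).
have gap2 : {ae mu, forall s, E s -> forall i j,
    quad (delta_mx 0 i + delta_mx 0 j) (l s) = qr (delta_mx 0 i + delta_mx 0 j) s}.
  have : {ae mu, forall s, forall i j, E s ->
      quad (delta_mx 0 i + delta_mx 0 j) (l s) = qr (delta_mx 0 i + delta_mx 0 j) s}.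
    by apply: filter_forall => i; apply: filter_forall => j; exact: gap.
  by apply: filterS => s h Es i j; exact: h.
have gap1 : {ae mu, forall s, E s -> forall i,
    quad (delta_mx 0 i) (l s) = qr (delta_mx 0 i) s}.
  have : {ae mu, forall s, forall i, E s -> quad (delta_mx 0 i) (l s) = qr (delta_mx 0 i) s}.
    by apply: filter_forall => i; exact: gap.
  by apply: filterS => s h Es i; exact: h.
apply: (filterS3 _ _ aeE gap1 gap2) => s Es /(_ Es) g1 /(_ Es) g2.
apply/matrixP => i j; rewrite (polarization _ _ (lsym s)) mxE.
by rewrite g2 !g1.
Qed.

End ConeClosed.

(** * Jets of quadratic functions *)

Section Jets.
Variables (R : realType) (D : nat).
Local Notation mu := (lebesgue01 R).
Local Notation H := (symL2 R D).

Lemma cvg_mx_entry (T : Type) (F : set_system T) (f : T -> 'M[R]_D)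
    (A : 'M[R]_D) i j : Filter F -> f x @[x --> F] --> A -> f x i j @[x --> F] --> A i j.
Proof.
by move=> FF fA; exact: (cvg_comp _ _ fA (@coord_continuous _ _ _ i j A)).
Qed.

Lemma symL2_addZ_ae (x y : H) a : {ae mu, forall s, symL2_repr (x + a *: y) s = x s + a *: y s}.
Proof.
elim/symL2_ind: x => f; elim/symL2_ind: y => g.
rewrite [a *: _]pi_symL2_scale -pi_symL2D.
by apply: (filterS3 _ _ (symL2_reprE (f + a *: g)) (symL2_reprE f) (symL2_reprE g))
  => s -> -> ->.
Qed.

Lemma psdmx_addZ (A B : 'M[R]_D) a : 0 <= a -> psdmx A -> psdmx B -> psdmx (A + a *: B).
Proof.
move=> a0 [sA psdA] [sB psdB]; split; first by rewrite linearD linearZ/= sA sB.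
move=> v; rewrite mulmxDr mulmxDl -scalemxAr -scalemxAl [leRHS]mxE.
by rewrite [X in _ + X]mxE addr_ge0// mulr_ge0.
Qed.

Lemma cone_addZ (x y : H) a : 0 <= a -> cone R D x -> cone R D y -> cone R D (x + a *: y).
Proof.
move=> a0 [m xm [m1 m2 m3 m4]] [n yn [n1 n2 n3 n4]].
exists (fun s => m s + a *: n s).
  by apply: (filterS3 _ _ (symL2_addZ_ae x y a) xm yn) => s -> -> ->.
split.
- by move=> s s01; apply: psdmx_addZ; [|exact: m1|exact: n1].
- move=> s t s01 t01 st; rewrite opprD addrACA -scalerBr.
  by apply: psdmx_addZ; [|exact: m2|exact: n2].
- move=> s s01; apply: cvg_mx_entries => i j; rewrite !mxE.
  under eq_fun do rewrite !mxE.
  apply: cvgD; first by apply: cvg_mx_entry; exact: m3.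
  apply: cvgM; first exact: cvg_cst.
  by apply: cvg_mx_entry; exact: n3.
- move=> s s01; have /cvg_ex[/= A mA] := m4 s s01; have /cvg_ex[/= B nB] := n4 s s01.
  apply/cvg_ex; exists (A + a *: B); apply: cvg_mx_entries => i j; rewrite !mxE.
  under eq_fun do rewrite !mxE.
  apply: cvgD; first by apply: cvg_mx_entry; exact: mA.
  apply: cvgM; first exact: cvg_cst.
  by apply: cvg_mx_entry; exact: nB.
Qed.

Lemma symL2_dotE2 (x : H) : symL2_dot x x = `|x| ^+ 2.
Proof. by rewrite symL2_normE sqr_sqrtr// symL2_dot_ge0. Qed.

Lemma symL2_dotBr (x y z : H) : symL2_dot z (x - y) = symL2_dot z x - symL2_dot z y.
Proof. by rewrite !(symL2_dotC z) symL2_dotD -[- y]scaleN1r symL2_dotZ mulN1r. Qed.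

Lemma symL2_dotBl (x y z : H) : symL2_dot (x - y) z = symL2_dot x z - symL2_dot y z.
Proof. by rewrite !(symL2_dotC _ z) symL2_dotBr. Qed.

(** Two jets differ by a linear form that is negligible against the step along the cone. A form
    vanishing in all admissible directions is zero, since the orthogonal of the cone is trivial. *)
Lemma has_jet_uniq (phi : R * H -> R) z d d' : pos_cone R D z ->
  has_jet phi z d -> has_jet phi z d' -> d = d'.
Proof.
move=> [/= t0 xz] /eqoP hd /eqoP hd'.
have diff e : 0 < e -> \forall w \near within (pos_cone R D) (nbhs z),
    `|(d.1 - d'.1) * (w.1 - z.1) + symL2_dot (d.2 - d'.2) (w.2 - z.2)| <=
    e * (`|w.1 - z.1| + `|w.2 - z.2|).
  move=> e0; have e20 : 0 < e / 2 by rewrite divr_gt0.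
  apply: filterS2 (hd _ e20) (hd' _ e20) => w.
  rewrite (ger0_norm (_ : 0 <= `|w.1 - z.1| + `|w.2 - z.2|)) ?addr_ge0//.
  move=> h1 h2; have := ler_normD (jet_error phi z d' w) (- jet_error phi z d w).
  rewrite normrN => /le_trans/(_ (lerD h2 h1)).
  rewrite -mulrDl -splitr; apply: le_trans; rewrite le_eqVlt; apply/orP; left; apply/eqP.
  congr (`| _ |); rewrite /jet_error symL2_dotBl; ring.
(* A direction (tau, y) keeping z in the cone for small steps is orthogonal to d - d'. *)
have dir (tau : R) (y : H) : 0 <= tau -> cone R D y ->
    (d.1 - d'.1) * tau + symL2_dot (d.2 - d'.2) y = 0.
  move=> tau0 yc; apply/eqP; rewrite -normr_eq0 eq_le normr_ge0 andbT.
  pose N := `|tau| + `|y|.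
  suff : forall e, 0 < e -> `|(d.1 - d'.1) * tau + symL2_dot (d.2 - d'.2) y| <= e * N.
    move=> h; apply/ler_addgt0Pl => e e0; rewrite addr0.
    have N1 : 0 < N + 1 by rewrite ltr_wpDl// addr_ge0.
    apply: (le_trans (h (e / (N + 1)) (divr_gt0 e0 N1))).
    by rewrite mulrAC ler_pdivrMr// ler_wpM2l ?(ltW e0)// lerDl.
  move=> e e0; have /nbhs_ballP[r /= r0 rP] := diff e e0.
  have N1 : 0 < N + 1 by rewrite ltr_wpDl// addr_ge0.
  (* The step [h] times (tau, y) then stays within the ball of radius [r]; N + 1 is used because N
     may be 0. *)
  pose h := r / 2 / (N + 1).
  have h0 : 0 < h by rewrite !divr_gt0.
  have hN : h * N < r.
    rewrite /h mulrAC ltr_pdivrMr//.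
    have N0 : 0 <= N by rewrite addr_ge0.
    nra.
  clearbody h.
  have := rP (z.1 + h * tau, z.2 + h *: y) _ _.
  have e1 : z.1 + h * tau - z.1 = h * tau by rewrite addrAC subrr add0r.
  have e2 : z.2 + h *: y - z.2 = h *: y by rewrite addrAC subrr add0r.
  rewrite /= e1 e2.
  have -> : (d.1 - d'.1) * (h * tau) + symL2_dot (d.2 - d'.2) (h *: y) =
      h * ((d.1 - d'.1) * tau + symL2_dot (d.2 - d'.2) y).
    by rewrite (symL2_dotC _ (h *: y)) symL2_dotZ (symL2_dotC y); ring.
  rewrite !normrM normrZ (ger0_norm (ltW h0)) -mulrDr mulrCA ler_pM2l//; apply.
    have tN : h * `|tau| <= h * N by rewrite ler_wpM2l ?(ltW h0)// lerDl.
    have yN : h * `|y| <= h * N by rewrite ler_wpM2l ?(ltW h0)// lerDr.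
    split => /=; rewrite -ball_normE /ball_/=.
      rewrite opprD addrA subrr sub0r normrN normrM (ger0_norm (ltW h0)).
      exact: le_lt_trans hN.
    rewrite opprD addrA subrr sub0r normrN normrZ (ger0_norm (ltW h0)).
    exact: le_lt_trans hN.
  split => /=; first by rewrite ltr_wpDr// mulr_ge0// ltW.
  by apply: cone_addZ => //; exact: ltW.
have cone0 : cone R D 0.
  exists (fun=> 0).
    have -> : 0 = \pi_(symL2 R D)%qT 0 :> H by rewrite !piE.
    exact: symL2_reprE.
  split=> *; [exact: psdmx0|by rewrite subrr; exact: psdmx0|exact: cvg_cst|exact: is_cvg_cst].
(* The direction (1, 0) identifies the time derivatives, and the directions (0, y) below identify
   the gradients. *)
have d1 : d.1 = d'.1.
  have := dir 1 0 ler01 cone0; rewrite symL2_dotC symL2_dot0 mulr1 addr0.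
  by move/eqP; rewrite subr_eq0 => /eqP.
have d2 : d.2 = d'.2.
  apply/eqP; rewrite -subr_eq0; apply/eqP; apply: cone_orthogonal_eq0 => y yc.
  by have := dir 0 y (lexx 0) yc; rewrite mulr0 add0r.
by rewrite [d]surjective_pairing d1 d2 -surjective_pairing.
Qed.

(** The doubled and perturbed function has this form, up to [u] or [v] and a constant, in either
    pair of variables once the other pair is frozen. *)
Definition quad_test (al be ga : R) (xi : H) (w : R * H) : R :=
  al * w.1 ^+ 2 + be * w.1 + ga * symL2_dot w.2 w.2 + symL2_dot xi w.2.

Definition quad_jet (al be ga : R) (xi : H) (w : R * H) : R * H :=
  (2 * al * w.1 + be, (2 * ga) *: w.2 + xi).

Section QuadTest.
Variables (al be ga : R) (xi : H).
Local Notation phi := (quad_test al be ga xi).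
Local Notation Dphi := (quad_jet al be ga xi).

(** The Taylor expansion stops at order two, so the error is known exactly; this one formula yields
    both the o and the O bounds required of a smooth function. *)
Lemma quad_jet_error z w :
  jet_error phi z (Dphi z) w = al * (w.1 - z.1) ^+ 2 + ga * `|w.2 - z.2| ^+ 2.
Proof.
rewrite /jet_error /quad_test /quad_jet/= -symL2_dotE2.
rewrite !(symL2_dotBr, symL2_dotBl, symL2_dotD, symL2_dotZ) (symL2_dotC w.2 z.2).
move: w.1 z.1 => t s; do ?[move: (symL2_dot _ _) => ?]; ring.
Qed.

Lemma quad_jet_error_le z w :
  `|jet_error phi z (Dphi z) w| <=
  (`|al| + `|ga|) * (`|w.1 - z.1| ^+ 2 + `|w.2 - z.2| ^+ 2).
Proof.
rewrite quad_jet_error (le_trans (ler_normD _ _))// (normrM al) (normrM ga) !normrX normr_id.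
have := normr_ge0 al; have := normr_ge0 ga.
have := sqr_ge0 `|w.1 - z.1|; have := sqr_ge0 `|w.2 - z.2|; nra.
Qed.

Lemma quad_has_jet z : has_jet phi z (Dphi z).
Proof.
apply/eqoP => e e0; apply: cvg_within.
pose K := `|al| + `|ga|; have K0 : 0 <= K by rewrite addr_ge0.
have K1 : 0 < K + 1 by rewrite ltr_wpDl.
near=> w; apply: (le_trans (quad_jet_error_le z w)).
rewrite (ger0_norm (_ : 0 <= `|w.1 - z.1| + `|w.2 - z.2|)) ?addr_ge0//.
rewrite -/K.
have small : `|w.1 - z.1| < e / (K + 1) /\ `|w.2 - z.2| < e / (K + 1).
  near: w; apply/nbhs_ballP; exists (e / (K + 1)); first exact: divr_gt0.
  by move=> w [] /=; rewrite -!ball_normE /ball_/= (distrC z.1) (distrC z.2).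
case: small; rewrite !ltr_pdivlMr//.
have := normr_ge0 (w.1 - z.1); have := normr_ge0 (w.2 - z.2).
move: `|w.1 - z.1| `|w.2 - z.2| => a b b0 a0 ha hb.
have h1 : a * (a * (K + 1)) <= a * e by rewrite ler_wpM2l// ltW.
have h2 : b * (b * (K + 1)) <= b * e by rewrite ler_wpM2l// ltW.
have h3 := sqr_ge0 a; have h4 := sqr_ge0 b.
rewrite !expr2 in h3 h4 *; lra.
Unshelve. all: by end_near. Qed.

Lemma quad_jetE z : pos_cone R D z -> jet phi z = Dphi z.
Proof.
move=> zc; apply: xget_unique; first exact: quad_has_jet.
by move=> d hd; apply: (has_jet_uniq zc hd); exact: quad_has_jet.
Qed.

Lemma quad_smooth : smooth_on_cone phi.
Proof.
split.
- move=> z zc; exists (Dphi z); split; first exact: quad_has_jet.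
  by move=> d hd; apply: (has_jet_uniq zc _ hd); exact: quad_has_jet.
- move=> z zc; rewrite quad_jetE//; apply/eqO_exP.
  exists (`|al| + `|ga| + 1); first by rewrite ltr_wpDl// addr_ge0.
  apply: nearW => w; apply: (le_trans (quad_jet_error_le z w)).
  rewrite (ger0_norm (_ : 0 <= `|w.1 - z.1| ^+ 2 + `|w.2 - z.2| ^+ 2)).
    by rewrite ler_wpM2r ?lerDl// addr_ge0// sqr_ge0.
  by rewrite addr_ge0// sqr_ge0.
(* The value of [jet] is known on the cone only, where it coincides with the everywhere continuous
   [Dphi]. *)
- apply: (@subspace_eq_continuous _ _ _ Dphi).
    by move=> z /set_mem zc; exact/esym/quad_jetE.
  apply: continuous_subspaceT => z.
  have c1 : 2 * al * w.1 + be @[w --> z] --> 2 * al * z.1 + be.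
    apply: cvgD; last exact: cvg_cst.
    by apply: cvgM; [exact: cvg_cst|exact: cvg_fst].
  have c2 : (2 * ga) *: w.2 + xi @[w --> z] --> (2 * ga) *: z.2 + xi.
    apply: cvgD; last exact: cvg_cst.
    by apply: cvgZ; [exact: cvg_cst|exact: cvg_snd].
  exact: (cvg_pair c1 c2).
Qed.

End QuadTest.

End Jets.

(** * Perturbed maxima *)

Section StrongMaximum.
Variables (R : realType) (V : lmodType R) (dot : V -> V -> R).
Hypothesis dotC : forall x y, dot x y = dot y x.
Hypothesis dot_linear : forall a x y z, dot (a *: x + y) z = a * dot x z + dot y z.
Hypothesis dot_ge0 : forall x, 0 <= dot x x.
Local Notation nsq x := (dot x x).
Local Notation half n := ((2^-1 : R) ^+ n).
(** Completeness, for geometrically decreasing increments measured in squared norm. The factor 16 is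
    the one obtained for a product of four spaces, each contributing 4. *)
Hypothesis dot_complete : forall (v : nat -> V) (C : R), 0 < C ->
  (forall n, nsq (v n.+1 - v n) <= C * half n ^+ 2) ->
  exists l, forall n, nsq (v n - l) <= 16 * C * half n ^+ 2.

Lemma dotDl x y z : dot (x + y) z = dot x z + dot y z.
Proof. by have := dot_linear 1 x y z; rewrite scale1r mul1r. Qed.

Lemma dotZl a x z : dot (a *: x) z = a * dot x z.
Proof.
have dot0 : dot 0 z = 0.
  by have /eqP := dotDl 0 0 z; rewrite addr0 -subr_eq0 opprD addrA subrr add0r oppr_eq0 => /eqP.
by have := dot_linear a x 0 z; rewrite !addr0 dot0 addr0.
Qed.

Lemma dotDr x y z : dot z (x + y) = dot z x + dot z y.
Proof. by rewrite !(dotC z) dotDl. Qed.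

Lemma dotZr a x z : dot z (a *: x) = a * dot z x.
Proof. by rewrite !(dotC z) dotZl. Qed.

Lemma dotNl x z : dot (- x) z = - dot x z.
Proof. by rewrite -scaleN1r dotZl mulN1r. Qed.

Lemma dotNr x z : dot z (- x) = - dot z x.
Proof. by rewrite !(dotC z) dotNl. Qed.

Definition dotE := (dotDl, dotDr, dotZl, dotZr, dotNl, dotNr).

Lemma nsqB_le x y z : nsq (x - z) <= 2 * (nsq (x - y) + nsq (y - z)).
Proof.
have := dot_ge0 ((x - y) - (y - z)).
have -> : x - z = (x - y) + (y - z) by rewrite addrA subrK.
move: (x - y) (y - z) => a b; rewrite !dotE (dotC b a).
lra.
Qed.

Lemma nsqB_sym x y : nsq (x - y) = nsq (y - x).
Proof. by rewrite -opprB dotNl dotNr opprK. Qed.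

Lemma dot_young s a b : 0 < s -> 2 * dot a b <= s * nsq a + s^-1 * nsq b.
Proof.
move=> s0; have := dot_ge0 (s *: a - b); rewrite !dotE (dotC b a) => h.
rewrite -(ler_pM2l s0) mulrDr [s * (s^-1 * _)]mulrA divff ?gt_eqF// mul1r.
lra.
Qed.

Lemma half_gt0 n : 0 < half n. Proof. by rewrite exprn_gt0// invr_gt0. Qed.

Lemma half_ge0 n : 0 <= half n. Proof. exact: ltW (half_gt0 n). Qed.

Lemma half_le1 n : half n <= 1.
Proof. by rewrite exprn_ile1// ?invr_ge0// invf_le1// ler1n. Qed.

Lemma le_of_half (x y B : R) N :
  (forall n, (N <= n)%N -> x <= y + B * half n) -> x <= y.
Proof.
move=> xy; have yc : y + B * half n @[n --> \oo] --> y + B * 0.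
  apply: cvgD; first exact: cvg_cst.
  apply: cvgM; first exact: cvg_cst.
  have := @cvg_geometric R 1 2^-1; rewrite /geometric/=.
  under eq_fun do rewrite mul1r; apply.
  by rewrite ger0_norm ?invr_ge0// invf_lt1// ltr1n.
rewrite -[y]addr0 -(mulr0 B); apply: (cvgr_to_ge yc).
by exists N => // n /= Nn; exact: xy.
Qed.

Lemma half_lt (e : R) : 0 < e -> exists n, half n < e.
Proof.
move=> e0; apply/not_existsP => h.
suff : e <= 0 by rewrite leNgt e0.
apply: (@le_of_half _ _ 1 0) => n _; rewrite add0r mul1r leNgt.
exact/negP/h.
Qed.

(* A quadratic perturbation of Phi of size controlled by eta and c, after which
   the image of every maximizing sequence converges: the Borwein-Preiss
   construction carried out through the map p, where no maximizer need exist. *)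
Lemma strong_max (Z : Type) (Phi : Z -> R) (p : Z -> V) (M c eta : R) (z0 : Z) :
  (forall z, Phi z <= M) -> 0 < c -> 0 < eta ->
  (forall z, Phi z <= Phi z0 + eta) ->
  exists m l, [/\ nsq (p z0 - m) <= 32 * (eta / c),
    nsq (l - m) <= 128 * (eta / c) &
    forall r, 0 < r -> exists2 th, 0 < th & forall z,
      (forall z', Phi z' - 2 * c * nsq (p z' - m) <=
                  Phi z - 2 * c * nsq (p z - m) + th) ->
      nsq (p z - l) < r].
Proof.
move=> PhiM c0 eta0 z0P.
pose near_max (Psi : Z -> R) (e : R) := [set z | forall z', Psi z' <= Psi z + e].
(* The penalties [ck] sum to 2c, the coefficient of the final perturbation. The tolerances decrease
   like 8^-k, so that the ratio of [ek] to [ck] is (eta / c) 4^-k and the centres converge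
   geometrically. *)
pose ck k := c * half k; pose ek k := eta * half k ^+ 3.
have ck0 k : 0 < ck k by rewrite mulr_gt0 ?half_gt0.
have ek0 k : 0 < ek k by rewrite mulr_gt0 ?exprn_gt0 ?half_gt0.
(* Stage 0 uses the given [z0], whose tolerance [ek 0] is eta. The final default is never reached,
   as near maximizers exist at every stage. *)
pose pick k (Psi : Z -> R) : Z :=
  if k is 0 then z0 else
  if pselect (exists z, near_max Psi (ek k) z) is left h then projT1 (cid h) else z0.
pose Psi := fix Psi k : Z -> R := if k is k'.+1 then
  fun z => Psi k' z - ck k' * nsq (p z - p (pick k' (Psi k'))) else Phi.
pose zk k := pick k (Psi k).
pose v k := p (zk k).
have PsiS k z : Psi k.+1 z = Psi k z - ck k * nsq (p z - v k) by [].
have PsiM k z : Psi k z <= M.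
  elim: k => [|k IH]; first exact: PhiM.
  by rewrite PsiS lerBlDr (le_trans IH)// lerDl mulr_ge0// ltW.
have zkP k z : Psi k z <= Psi k (zk k) + ek k.
  rewrite /zk; case: k z => [|k] z; first by rewrite /ek expr0 expr1n mulr1; exact: z0P.
  suff: near_max (Psi k.+1) (ek k.+1) (pick k.+1 (Psi k.+1)) by exact.
  rewrite /pick; case: pselect => [h|[]]; first exact: projT2 (cid h).
  have supP : has_sup (range (Psi k.+1)).
    by split; [exists (Psi k.+1 z0), z0|exists M => _ [z' _ <-]].
  have [_ [z1 _ <-] z1P] := sup_adherent (ek0 k.+1) supP.
  exists z1 => z'; rewrite -lerBlDr ltW// (le_lt_trans _ z1P)// lerD2r.
  by apply: (ub_le_sup supP.2); exists z'.
have Psi_diag k : Psi k.+1 (zk k) = Psi k (zk k).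
  have nsq0 : nsq (0 : V) = 0 by rewrite -[0 in X in dot X _](scale0r (0 : V)) dotZl mul0r.
  by rewrite PsiS /v subrr nsq0 mulr0 subr0.
pose C := 8 * (eta / c).
have q0 : 0 < eta / c by rewrite divr_gt0.
have C0 : 0 < C by rewrite mulr_gt0.
have C0' : 0 < 2 * (eta / c) by rewrite mulr_gt0.
have CE : 16 * (2 * (eta / c)) = 4 * C by rewrite /C; ring.
have ekE k : ek k = ck k * (eta / c) * half k ^+ 2.
  rewrite /ek /ck; have /gt_eqF/negbT cn := c0; by field.
have ekS k : ek k.+1 <= ek k.
  rewrite /ek ler_wpM2l ?(ltW eta0)// lerXn2r ?nnegrE ?half_ge0//.
  by rewrite exprS ler_piMl ?half_ge0// invf_le1// ler1n.
(* The penalty added at stage k vanishes at [zk k]; near maximality of [zk k] and [zk k.+1] then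
   bounds its value at [zk k.+1] by ek k + ek (k+1), at most 2 ek k. *)
have vS k : nsq (v k.+1 - v k) <= 2 * (eta / c) * half k ^+ 2.
  have h1 := zkP k.+1 (zk k); rewrite Psi_diag in h1.
  have h2 := zkP k (zk k.+1); have h3 := PsiS k (zk k.+1).
  have h4 := ekS k; rewrite -/(v k.+1) in h3.
  rewrite -(ler_pM2l (ck0 k)).
  have -> : ck k * (2 * (eta / c) * half k ^+ 2) = 2 * ek k by rewrite ekE; ring.
  lra.
have [l lP] := dot_complete C0' vS; rewrite CE in lP.
(* [mk k] is the barycentre of the v_j with weights 2^-(j+1) for j < k and the remaining weight 2^-k
   on v_k. *)
pose mk := fix mk k : V := if k is k'.+1 then
  mk k' + half k'.+1 *: (v k'.+1 - v k') else v 0.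
have mkS k : mk k.+1 = mk k + half k.+1 *: (v k.+1 - v k) by [].
have [m mP] : exists m, forall n, nsq (mk n - m) <= 4 * C * half n ^+ 2.
  rewrite -CE; apply: dot_complete => // n; rewrite mkS addrAC subrr add0r dotZl dotZr mulrA.
  have h1 := vS n; have := half_le1 n.+1; have := half_gt0 n.+1 => h2 h3.
  have : half n.+1 * half n.+1 <= 1 by rewrite mulr_ile1 ?half_ge0 ?half_le1.
  move=> h4; apply: le_trans h1; rewrite ler_piMl//.
have v0m : nsq (p z0 - m) <= 4 * C.
  by have := mP 0; rewrite expr0 expr1n mulr1.
(* The accumulated penalties amount to one quadratic about [mk k], up to a constant; the term in
   [ck k] compensates the weight not yet spent. *)
have PsiE k : exists kap, forall z,
    Psi k z = Phi z - 2 * c * nsq (p z - mk k) + 2 * ck k * nsq (p z - v k) + kap.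
  elim: k => [|k [kap IH]].
    by exists 0 => z; rewrite addr0 /ck expr0 mulr1 subrK.
  exists (kap + (2 * c * nsq (mk k.+1) - 2 * ck k.+1 * nsq (v k.+1)
     - 2 * c * nsq (mk k) + ck k * nsq (v k))) => z.
  have E2 : half k.+1 = half k / 2 by rewrite exprS mulrC.
  rewrite PsiS IH mkS /ck E2; move: (half k) (p z) (v k) (v k.+1) (mk k) => h x a b d.
  rewrite !dotE (dotC a x) (dotC b x) (dotC d x) (dotC b a) (dotC d a) (dotC d b).
  by field.
exists m, l; split.
- by rewrite /C in v0m; lra.
- have l0 : nsq (p z0 - l) <= 4 * C by have := lP 0; rewrite expr0 expr1n mulr1.
  apply: (le_trans (nsqB_le l (p z0) m)); rewrite (nsqB_sym l).
  by rewrite /C in v0m l0; lra.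
have PsiK k z j : Psi (k.+1 + j)%N z <= Psi k.+1 z.
  elim: j => [|j IH]; first by rewrite addn0.
  by rewrite addnS PsiS (le_trans _ IH)// gerBl mulr_ge0// ltW.
have hsq k : half k ^+ 2 <= half k.
  by rewrite expr2 ler_piMl ?half_ge0 ?half_le1.
have hmono k j : half (k + j)%N <= half k.
  by rewrite exprD ler_piMr ?half_ge0 ?half_le1.
have vv k j : nsq (v k - v (k + j)%N) <= 16 * C * half k ^+ 2.
  have h1 := nsqB_le (v k) l (v (k + j)%N); have h2 := lP k.
  have h3 := lP (k + j)%N; rewrite nsqB_sym in h3.
  have h4 : C * half (k + j)%N ^+ 2 <= C * half k ^+ 2.
    by rewrite ler_wpM2l ?(ltW C0)// lerXn2r ?nnegrE ?half_ge0.
  lra.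
(* The penalties of all later stages cost at most 128 ek k at [zk k], because the later centres stay
   close to [v k]. *)
have Psi_zk k j : Psi k (zk k) - 128 * ek k * (1 - half j) <= Psi (k.+1 + j)%N (zk k).
  elim: j => [|j IH]; first by rewrite addn0 Psi_diag expr0 subrr mulr0 subr0.
  have h1 := vv k j.+1; rewrite addnS -/(k.+1 + j)%N in h1.
  rewrite addnS PsiS -/(v k).
  have h2 : ck (k.+1 + j)%N * nsq (v k - v (k.+1 + j)%N) <= 128 * ek k * half j.+1.
    have -> : 128 * ek k * half j.+1 = ck (k.+1 + j)%N * (16 * C * half k ^+ 2).
      by rewrite ekE /C /ck addSnnS exprD; ring.
    by rewrite ler_wpM2l// ltW.
  have h3 : half j.+1 * 2 = half j by rewrite exprS mulrAC mulVf ?mul1r// pnatr_eq0.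
  rewrite -h3 in IH; nra.
(* Replacing [mk K] by its limit [m] costs O(2^-K), by Young's inequality with weight 2^-K. *)
have approx w K : nsq (w - mk K) - nsq (w - m) <= half K * (nsq (w - m) + 8 * C) /\
    nsq (w - m) - nsq (w - mk K) <= half K * (nsq (w - m) + 8 * C).
  have hK := half_gt0 K.
  have -> : w - mk K = (w - m) + (m - mk K) by rewrite addrA subrK.
  have := mP K; rewrite (nsqB_sym (mk K)); move: (w - m) (m - mk K) => a b nb.
  have h1 := dot_young a b hK.
  have h2 := dot_young a (- b) hK; rewrite !(dotNl, dotNr) opprK in h2.
  have h3 : (half K)^-1 * nsq b <= 4 * C * half K.
    rewrite mulrC ler_pdivrMr//.
    by have -> : 4 * C * half K * half K = 4 * C * half K ^+ 2 by ring.
  have h4 : nsq b <= 4 * C * half K.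
    by apply: (le_trans nb); rewrite ler_wpM2l ?hsq// mulr_ge0// ltW.
  have h5 := dot_ge0 b.
  rewrite !dotE (dotC b a); split; nra.
(* Letting K tend to infinity: if the limit perturbed function is nearly as large at [z] as at
   [zk k], then [p z] is close to [v k]. Of the 129, one comes from the near maximality of [zk k]
   and 128 from the later penalties. *)
have key k z : ck k * nsq (p z - v k) <= 129 * ek k +
    (Phi (zk k) - 2 * c * nsq (p (zk k) - m)) - (Phi z - 2 * c * nsq (p z - m)).
  pose B := 2 * c * (nsq (p z - m) + 8 * C) + 2 * c * (nsq (p (zk k) - m) + 8 * C) +
    4 * c * (nsq (p (zk k) - l) + 4 * C).
  apply: (@le_of_half _ _ B k.+1) => n /subnKC <-; move: (n - k.+1)%N => {n} j.
  set K := (k.+1 + j)%N.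
  have [kap kapP] := PsiE K.
  have h1 := PsiK k z j; have h2 := Psi_zk k j; rewrite -/K in h1 h2.
  rewrite PsiS in h1; have h3 := zkP k z; rewrite !kapP in h1 h2.
  have [h4 _] := approx (p z) K; have [_ h5] := approx (p (zk k)) K.
  have h6 : nsq (p (zk k) - v K) <= 2 * (nsq (p (zk k) - l) + 4 * C).
    have a1 := nsqB_le (p (zk k)) l (v K); have a2 := lP K.
    rewrite nsqB_sym in a2.
    have a3 : C * half K ^+ 2 <= C.
      by rewrite ler_piMr ?(ltW C0)//; exact: le_trans (hsq K) (half_le1 K).
    lra.
  have h7 : 0 <= 128 * ek k * half j.
    by rewrite mulr_ge0 ?half_ge0// mulr_ge0// ltW.
  have h8 : 0 <= ck K * nsq (p z - v K) by rewrite mulr_ge0// ltW.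
  have h9 : ck K * nsq (p (zk k) - v K) <= ck K * (2 * (nsq (p (zk k) - l) + 4 * C)).
    by rewrite ler_wpM2l// ltW.
  have h10 : c * (nsq (p z - mk K) - nsq (p z - m)) <=
      c * (half K * (nsq (p z - m) + 8 * C)) by rewrite ler_wpM2l// ltW.
  have h11 : c * (nsq (p (zk k) - m) - nsq (p (zk k) - mk K)) <=
      c * (half K * (nsq (p (zk k) - m) + 8 * C)) by rewrite ler_wpM2l// ltW.
  have -> : B * half K = 2 * (c * (half K * (nsq (p z - m) + 8 * C))) +
     2 * (c * (half K * (nsq (p (zk k) - m) + 8 * C))) +
     2 * (ck K * (2 * (nsq (p (zk k) - l) + 4 * C))) by rewrite /B /ck; ring.
  rewrite /= in h1 h2 h3.
  lra.
move=> r r0.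
set q := eta / c in q0 *.
(* Passing through [v k], the squared distance from [p z] to [l] is at most 2 (129 + 32) q 4^-k + r
   / 4, where 322 = 2 (129 + 32); this choice of k makes the first term at most r / 4. *)
have [k kP] : exists k, half k < r / (4 * 322 * q).
  by apply: half_lt; rewrite divr_gt0 ?(pmulr_lgt0 _ q0) -?natrM ?ltr0n.
exists (ck k * (r / 8)); first by rewrite mulr_gt0// divr_gt0.
move=> z zmax; have h1 := key k z; have h2 := zmax (zk k).
have h3 : nsq (p z - v k) <= 129 * (q * half k ^+ 2) + r / 8.
  rewrite -(ler_pM2l (ck0 k)) mulrDr.
  have -> : ck k * (129 * (q * half k ^+ 2)) = 129 * ek k by rewrite ekE /q; ring.
  lra.
have h4 := nsqB_le (p z) (v k) l; have h5 := lP k.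
have h6 : q * half k ^+ 2 <= r / (4 * 322).
  apply: (le_trans (ler_wpM2l (ltW q0) (hsq k))).
  rewrite mulrC -ler_pdivlMr// -mulrA -invfM; exact: ltW.
rewrite /C -/q in h5.
have : 4 * (8 * q) * half k ^+ 2 = 32 * (q * half k ^+ 2) by ring.
lra.
Qed.

End StrongMaximum.

(** * Completeness of the doubled space and norm-closedness of the cone *)

Section ProductSpace.
Variables (R : realType) (D : nat).
Local Notation mu := (lebesgue01 R).
Local Notation H := (symL2 R D).
Local Notation half n := ((2^-1 : R) ^+ n).

Lemma cvg_of_half (V : normedModType R) (x : nat -> V) l :
  (forall n, `|x n - l| <= half n) -> x @ \oo --> l.
Proof.
move=> xl; apply/cvgrPdist_le => e e0; have [N Ne] := half_lt e0.
exists N => // n /= Nn; rewrite distrC (le_trans (xl n))// (le_trans _ (ltW Ne))//.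
by rewrite -(subnK Nn) exprD ler_piMl ?half_ge0 ?half_le1.
Qed.

Lemma real_fast_cauchy (v : nat -> R) (C : R) : 0 < C ->
  (forall n, (v n.+1 - v n) ^+ 2 <= C * half n ^+ 2) ->
  exists l, forall n, (v n - l) ^+ 2 <= 4 * C * half n ^+ 2.
Proof.
move=> C0 vC; pose q := Num.sqrt C; have q0 : 0 < q by rewrite sqrtr_gt0.
have qq : q ^+ 2 = C by rewrite sqr_sqrtr// ltW.
have vcvg : cvgn v.
  apply: (@weighted_square_sum_cvg _ _ (2 * (1 + C))) => n.
  apply: (@le_trans _ _ (\sum_(0 <= k < n) half k * (1 + C))).
    apply: ler_sum => k _; rewrite mulrDr mulr1 lerD2l.
    apply: (le_trans (ler_wpM2l _ (vC k))); first by rewrite exprn_ge0.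
    have -> : 2 ^+ k * (C * half k ^+ 2) = (2 * 2^-1) ^+ k * (half k * C).
      by rewrite exprMn; ring.
    by rewrite divff// expr1n mul1r.
  rewrite -mulr_suml big_mkord ler_wpM2r ?geo_sum_le2//.
  by rewrite addr_ge0// ltW.
have dist n m : (n <= m)%N -> `|v n - v m| <= 2 * q * half n.
  move=> nm; have := @geometric_dist R R (fun k => q^-1 * v k) _ n m nm.
  rewrite -mulrBr normrM gtr0_norm ?invr_gt0// ler_pdivrMl//.
  rewrite mulrCA mulrA; apply=> k.
  rewrite -mulrBr normrM gtr0_norm ?invr_gt0// ler_pdivrMl//.
  rewrite -ler_sqr ?nnegrE ?mulr_ge0 ?(ltW q0) ?half_ge0//.
  by rewrite exprMn qq real_normK ?num_real.
exists (limn v) => n.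
rewrite -[leLHS]real_normK ?num_real//.
have -> : 4 * C * half n ^+ 2 = (2 * q * half n) ^+ 2 by rewrite -qq; ring.
rewrite lerXn2r ?nnegrE ?mulr_ge0 ?(ltW q0) ?half_ge0//.
have vl : `|v n - v m| @[m --> \oo] --> `|v n - limn v|.
  by apply: cvg_norm; apply: cvgB; [exact: cvg_cst|exact: vcvg].
by apply: (cvgr_to_le vl); exists n => // m /=; exact: dist.
Qed.

(** Division by the square root of [C] reduces to increments bounded by 2^-n. *)
Lemma symL2_fast_cauchy (x : nat -> H) (C : R) : 0 < C ->
  (forall n, symL2_dot (x n.+1 - x n) (x n.+1 - x n) <= C * half n ^+ 2) ->
  exists l, forall n, symL2_dot (x n - l) (x n - l) <= 4 * C * half n ^+ 2.
Proof.
move=> C0 xC; pose q := Num.sqrt C; have q0 : 0 < q by rewrite sqrtr_gt0.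
have qq : q ^+ 2 = C by rewrite sqr_sqrtr// ltW.
have [n|l [lP _]] := @symL2_complete R D (fun k => q^-1 *: x k).
  rewrite -scalerBr normrZ gtr0_norm ?invr_gt0// ler_pdivrMl//.
  rewrite -ler_sqr ?nnegrE ?mulr_ge0 ?(ltW q0) ?half_ge0//.
  by rewrite exprMn qq -symL2_dotE2.
exists (q *: l) => n; rewrite symL2_dotE2.
have -> : 4 * C * half n ^+ 2 = (q * (2 * half n)) ^+ 2 by rewrite -qq; ring.
rewrite lerXn2r ?nnegrE ?mulr_ge0 ?(ltW q0) ?half_ge0//.
have -> : x n - q *: l = q *: (q^-1 *: x n - l).
  by rewrite scalerBr scalerA divff ?scale1r// gt_eqF.
by rewrite normrZ gtr0_norm// ler_pM2l.
Qed.

(** A sequence in the cone approaching [l] geometrically also converges almost everywhere, where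
    [cone_closed] applies. *)
Lemma cone_norm_closed (l : H) :
  (forall e, 0 < e -> exists2 x, cone R D x & `|x - l| < e) -> cone R D l.
Proof.
move=> lP.
have /choice[x xP] n : exists x, cone R D x /\ `|x - l| < half n / 2.
  by have [|x xc xl] := lP (half n / 2); [rewrite divr_gt0 ?half_gt0|exists x].
have xS n : `|x n.+1 - x n| <= half n.
  apply: (le_trans (ler_distD l _ _)); rewrite [`|l - _|]distrC.
  have [_ h1] := xP n; have [_ h2] := xP n.+1; rewrite exprS in h2.
  have := half_ge0 R n; lra.
have [l' [xl' ael']] := symL2_complete xS.
suff -> : l = l' by apply: cone_closed ael' => n; case: (xP n).
apply/eqP; rewrite -subr_eq0 -normr_le0.
apply: (@le_of_half _ _ _ 3 0) => n _; rewrite add0r.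
apply: (le_trans (ler_distD (x n) _ _)); rewrite [`|l - _|]distrC.
have [_ h1] := xP n; have h2 := xl' n; have := half_ge0 R n; lra.
Qed.

(** Elements are ((t, x), (s, y)): the variables of [u], then those of [v]. The type [R^o] makes the
    time factor a module over [R]. *)
Definition V4 : lmodType R := (R^o * H * (R^o * H))%type.

Definition dot4 (a b : V4) : R :=
  a.1.1 * b.1.1 + symL2_dot a.1.2 b.1.2 + (a.2.1 * b.2.1 + symL2_dot a.2.2 b.2.2).

Lemma dot4C a b : dot4 a b = dot4 b a.
Proof.
by rewrite /dot4 (symL2_dotC a.1.2) (symL2_dotC a.2.2) (mulrC a.1.1) (mulrC a.2.1).
Qed.

Lemma dot4_linear k a b z : dot4 (k *: a + b) z = k * dot4 a z + dot4 b z.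
Proof.
rewrite /dot4 /= !symL2_dot_linear.
rewrite -[(k *: a.1.1)]/(k * a.1.1) -[(k *: a.2.1)]/(k * a.2.1).
do ?[move: (symL2_dot _ _) => ?]; move: a.1.1 a.2.1 b.1.1 b.2.1 z.1.1 z.2.1 => *; ring.
Qed.

Lemma dot4_sqr (a : V4) :
  dot4 a a = a.1.1 ^+ 2 + `|a.1.2| ^+ 2 + (a.2.1 ^+ 2 + `|a.2.2| ^+ 2).
Proof. by rewrite /dot4 !symL2_dotE2 !expr2. Qed.

Lemma dot4_ge0 a : 0 <= dot4 a a.
Proof. by rewrite dot4_sqr !addr_ge0 ?sqr_ge0. Qed.

Lemma dot4_components (a : V4) e : 0 <= e -> dot4 a a <= e ^+ 2 ->
  [/\ `|a.1.1| <= e, `|a.1.2| <= e, `|a.2.1| <= e & `|a.2.2| <= e].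
Proof.
move=> e0; rewrite dot4_sqr -(real_normK (num_real a.1.1)) -(real_normK (num_real a.2.1)) => h.
have h1 := sqr_ge0 `|a.1.1|; have h2 := sqr_ge0 `|a.1.2|.
have h3 := sqr_ge0 `|a.2.1|; have h4 := sqr_ge0 `|a.2.2|.
by move: h h1 h2 h3 h4; split; rewrite -ler_sqr ?nnegrE//; lra.
Qed.

Lemma dot4_complete (v : nat -> V4) (C : R) : 0 < C ->
  (forall n, dot4 (v n.+1 - v n) (v n.+1 - v n) <= C * half n ^+ 2) ->
  exists l, forall n, dot4 (v n - l) (v n - l) <= 16 * C * half n ^+ 2.
Proof.
move=> C0 vC.
have bound n : [/\ ((v n.+1).1.1 - (v n).1.1) ^+ 2 <= C * half n ^+ 2,
    symL2_dot ((v n.+1).1.2 - (v n).1.2) ((v n.+1).1.2 - (v n).1.2) <= C * half n ^+ 2,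
    ((v n.+1).2.1 - (v n).2.1) ^+ 2 <= C * half n ^+ 2 &
    symL2_dot ((v n.+1).2.2 - (v n).2.2) ((v n.+1).2.2 - (v n).2.2) <= C * half n ^+ 2].
  have := vC n; rewrite dot4_sqr/= -!symL2_dotE2.
  set a1 := (_ - _) ^+ 2; set a2 := symL2_dot _ _.
  set a3 := (_ - _) ^+ 2; set a4 := symL2_dot _ _.
  have h1 : 0 <= a1 by exact: sqr_ge0. have h2 : 0 <= a2 by exact: symL2_dot_ge0.
  have h3 : 0 <= a3 by exact: sqr_ge0. have h4 : 0 <= a4 by exact: symL2_dot_ge0.
  by move=> h; split; lra.
have [l1 l1P] : exists l, forall n, ((v n).1.1 - l) ^+ 2 <= 4 * C * half n ^+ 2.
  by apply: real_fast_cauchy => // n; case: (bound n).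
have [l2 l2P] : exists l, forall n,
    symL2_dot ((v n).1.2 - l) ((v n).1.2 - l) <= 4 * C * half n ^+ 2.
  by apply: symL2_fast_cauchy => // n; case: (bound n).
have [l3 l3P] : exists l, forall n, ((v n).2.1 - l) ^+ 2 <= 4 * C * half n ^+ 2.
  by apply: real_fast_cauchy => // n; case: (bound n).
have [l4 l4P] : exists l, forall n,
    symL2_dot ((v n).2.2 - l) ((v n).2.2 - l) <= 4 * C * half n ^+ 2.
  by apply: symL2_fast_cauchy => // n; case: (bound n).
exists ((l1, l2), (l3, l4)) => n; rewrite dot4_sqr/= -!symL2_dotE2.
have := l1P n; have := l2P n; have := l3P n; have := l4P n; lra.
Qed.

End ProductSpace.

(** * An exact maximum after perturbation in all variables *)

Section AttainedMax.
Variables (R : realType) (D : nat).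
Local Notation H := (symL2 R D).
Local Notation half n := ((2^-1 : R) ^+ n).
Local Notation V4 := (V4 R D).

Lemma dot4_cvg (z : nat -> V4) (l m : V4) :
  (z n).1.1 @[n --> \oo] --> (l.1.1 : R) -> (z n).1.2 @[n --> \oo] --> l.1.2 ->
  (z n).2.1 @[n --> \oo] --> (l.2.1 : R) -> (z n).2.2 @[n --> \oo] --> l.2.2 ->
  dot4 (z n - m) (z n - m) @[n --> \oo] --> dot4 (l - m) (l - m).
Proof.
have sq (V : normedModType R) (x : nat -> V) y k : x @ \oo --> y ->
    `|x n - k| ^+ 2 @[n --> \oo] --> `|y - k| ^+ 2.
  move=> xy; exact: (cvg_comp (fun n => `|x n - k|) (fun a => a ^+ 2)
    (cvg_norm (cvgB xy (cvg_cst k))) (@exprn_continuous R 2 _)).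
have sqR (x : nat -> R) y k : x @ \oo --> y ->
    (x n - k) ^+ 2 @[n --> \oo] --> (y - k) ^+ 2.
  move=> xy; exact: (cvg_comp (fun n => x n - k) (fun a => a ^+ 2)
    (cvgB xy (cvg_cst k)) (@exprn_continuous R 2 _)).
move=> h1 h2 h3 h4; rewrite dot4_sqr.
rewrite (_ : (fun n => dot4 (z n - m) (z n - m)) = (fun n =>
  ((z n).1.1 - m.1.1) ^+ 2 + `|(z n).1.2 - m.1.2| ^+ 2 +
  (((z n).2.1 - m.2.1) ^+ 2 + `|(z n).2.2 - m.2.2| ^+ 2))); last first.
  by apply/funext => n; exact: dot4_sqr.
apply: cvgD; apply: cvgD.
- exact: (sqR (fun n => (z n).1.1) _ m.1.1 h1).
- exact: (sq _ (fun n => (z n).1.2) _ m.1.2 h2).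
- exact: (sqR (fun n => (z n).2.1) _ m.2.1 h3).
- exact: (sq _ (fun n => (z n).2.2) _ m.2.2 h4).
Qed.

Definition good : set V4 :=
  [set z | (0 <= z.1.1 /\ cone R D z.1.2) /\ (0 <= z.2.1 /\ cone R D z.2.2)].

Lemma near_max (T : Type) (A : set T) (f : T -> R) (M e : R) (z0 : T) :
  A z0 -> (forall z, A z -> f z <= M) -> 0 < e ->
  exists2 z, A z & forall z', A z' -> f z' <= f z + e.
Proof.
move=> z0A fM e0.
have supP : has_sup (f @` A).
  by split; [exists (f z0), z0|exists M => _ [z zA <-]; exact: fM].
have [_ [z zA <-] zP] := sup_adherent e0 supP.
exists z => // z' z'A; rewrite -lerBlDr ltW// (le_lt_trans _ zP)// lerD2r.
by apply: (ub_le_sup supP.2); exists z'.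
Qed.

(** This is [strong_max] with [p] the inclusion and c = 1: near maximizers now converge in all four
    variables. Closedness of the cone keeps their limit in the domain, and continuity makes it a
    maximizer. *)
Lemma attained_max (Phi : V4 -> R) (M eta : R) (z0 : V4) :
  (forall z, good z -> Phi z <= M) -> 0 < eta -> good z0 ->
  (forall z, good z -> Phi z <= Phi z0 + eta) ->
  (forall (z : nat -> V4) l, (forall n, good (z n)) -> good l ->
     (z n).1.1 @[n --> \oo] --> (l.1.1 : R) -> (z n).1.2 @[n --> \oo] --> l.1.2 ->
     (z n).2.1 @[n --> \oo] --> (l.2.1 : R) -> (z n).2.2 @[n --> \oo] --> l.2.2 ->
     Phi (z n) @[n --> \oo] --> Phi l) ->
  exists m l, [/\ good l, dot4 (z0 - m) (z0 - m) <= 32 * eta,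
    dot4 (l - m) (l - m) <= 128 * eta &
    forall z, good z -> Phi z - 2 * dot4 (z - m) (z - m) <= Phi l - 2 * dot4 (l - m) (l - m)].
Proof.
move=> PhiM eta0 z0g z0P Phic.
pose Z := {z : V4 | good z}.
have [m [l [z0m lm strong]]] := @strong_max R V4 (@dot4 R D) (@dot4C R D)
  (@dot4_linear R D) (@dot4_ge0 R D)
  (@dot4_complete R D) Z (fun z => Phi (sval z)) (fun z => sval z) M 1 eta (exist _ z0 z0g)
  (fun z => PhiM _ (svalP z)) ltr01 eta0 (fun z => z0P _ (svalP z)).
rewrite !divr1/= in z0m lm strong.
pose Phi2 z := Phi z - 2 * dot4 (z - m) (z - m).
have strong2 r : 0 < r -> exists2 th, 0 < th & forall z, good z ->
    (forall z', good z' -> Phi2 z' <= Phi2 z + th) -> dot4 (z - l) (z - l) < r.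
  move=> r0; have [th th0 thP] := strong r r0; exists th => // z zg zP.
  have := thP (exist _ z zg); rewrite /= !mulr1; apply=> z'.
  exact: zP (svalP z').
have Phi2M z : good z -> Phi2 z <= M.
  by move=> zg; rewrite /Phi2 lerBlDr (le_trans (PhiM _ zg))// lerDl mulr_ge0// dot4_ge0.
have /choice[z zP] n : exists z, [/\ good z, dot4 (z - l) (z - l) < half n ^+ 2 &
    forall z', good z' -> Phi2 z' <= Phi2 z + half n].
  have h0 : 0 < half n ^+ 2 by rewrite exprn_gt0// half_gt0.
  have [th th0 thP] := strong2 _ h0.
  (* The smaller of the two tolerances makes [z] both close to [l] and maximal up to 2^-n. *)
  have [|z zg zm] := @near_max _ good Phi2 M (Num.min th (half n)) z0 z0g Phi2M.
    by rewrite lt_min th0 half_gt0.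
  exists z; split=> // [|z' z'g].
    by apply: thP => // z' z'g; rewrite (le_trans (zm _ z'g))// lerD2l ge_min lexx.
  by rewrite (le_trans (zm _ z'g))// lerD2l ge_min lexx orbT.
have comp n : [/\ `|(z n).1.1 - l.1.1| <= half n, `|(z n).1.2 - l.1.2| <= half n,
    `|(z n).2.1 - l.2.1| <= half n & `|(z n).2.2 - l.2.2| <= half n].
  by case: (zP n) => _ /ltW h _; exact: dot4_components (half_ge0 R n) h.
have c11 : (z n).1.1 @[n --> \oo] --> (l.1.1 : R) by apply: cvg_of_half => n; case: (comp n).
have c12 : (z n).1.2 @[n --> \oo] --> l.1.2 by apply: cvg_of_half => n; case: (comp n).
have c21 : (z n).2.1 @[n --> \oo] --> (l.2.1 : R) by apply: cvg_of_half => n; case: (comp n).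
have c22 : (z n).2.2 @[n --> \oo] --> l.2.2 by apply: cvg_of_half => n; case: (comp n).
have zg n : good (z n) by case: (zP n).
have lg : good l.
  split; split.
  - by apply: (cvgr_to_ge c11); apply: nearW => n; case: (zg n) => [[]].
  - apply: cone_norm_closed => e e0; have [n ne] := half_lt e0.
    exists (z n).1.2; first by case: (zg n) => [[]].
    by case: (comp n) => _ h _ _; exact: le_lt_trans ne.
  - by apply: (cvgr_to_ge c21); apply: nearW => n; case: (zg n) => _ [].
  - apply: cone_norm_closed => e e0; have [n ne] := half_lt e0.
    exists (z n).2.2; first by case: (zg n) => _ [].
    by case: (comp n) => _ _ _ h; exact: le_lt_trans ne.
have Phi2c : Phi2 (z n) @[n --> \oo] --> Phi2 l.
  apply: cvgB; first exact: Phic.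
  by apply: cvgM; [exact: cvg_cst|exact: dot4_cvg].
exists m, l; split; [exact: lg|exact: z0m|exact: lm|].
suff : forall z', good z' -> Phi2 z' <= Phi2 l by [].
clearbody Phi2 => z' z'g.
have bc : Phi2 (z n) + half n @[n --> \oo] --> Phi2 l + 0.
  apply: cvgD => //; apply: cvg_of_half => n.
  by rewrite subr0 ger0_norm ?half_ge0.
have l0 : Phi2 l + 0 = Phi2 l by exact: addr0.
rewrite l0 in bc; apply: (cvgr_to_ge bc); apply: nearW => n.
by case: (zP n) => _ _ h; exact: h.
Qed.

End AttainedMax.

(** * Doubling of variables *)

Section Comparison.
Variables (R : realType) (D : nat).
Local Notation H := (symL2 R D).
Local Notation V4 := (V4 R D).
Local Notation good := (@good R D).

Lemma lipschitz_nonneg_cone (u : R * H -> R) : [lipschitz u z | z in nonneg_cone R D] ->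
  exists2 K, 0 < K & forall z w, nonneg_cone R D z -> nonneg_cone R D w ->
    u z - u w <= K * (`|z.1 - w.1| + `|z.2 - w.2|).
Proof.
move=> [M [_ MP]]; pose K := `|M| + 1.
have K0 : 0 < K by rewrite ltr_wpDl.
have MK : M < K by rewrite (le_lt_trans (ler_norm M))// ltrDl.
exists K => // z w zc wc; apply: (le_trans (ler_norm _)).
apply: (le_trans (MP K MK (z, w) (conj zc wc))) => /=.
rewrite ler_wpM2l ?(ltW K0)// [leLHS]prod_normE/=.
by rewrite ge_max lerDl lerDr !normr_ge0.
Qed.

(** The modulus of continuity at one fixed point, which turns closeness of both gradients to that
    point into closeness of the values of [F]. *)
Lemma locally_lipschitz_cvg (F : H -> R) p e : locally_lipschitz F -> 0 < e ->
  exists2 r, 0 < r & forall q, `|q - p| < r -> `|F q - F p| < e.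
Proof.
move=> Flip e0; have [U Up [M [_ MP]]] := Flip p.
have /nbhs_ballP[r0 /= r00 r0U] := Up.
pose K := `|M| + 1; have K0 : 0 < K by rewrite ltr_wpDl.
have MK : M < K by rewrite (le_lt_trans (ler_norm M))// ltrDl.
exists (Num.min r0 (e / K)); first by rewrite lt_min r00 divr_gt0.
move=> q; rewrite lt_min => /andP[qr0 qe].
have qU : U q by apply: r0U; rewrite -ball_normE/= distrC.
have pU : U p by apply: r0U; exact: ballxx.
apply: (le_lt_trans (MP K MK (q, p) (conj qU pU))) => /=.
by rewrite mulrC -ltr_pdivlMr.
Qed.

Lemma lipschitz_cvg (u : R * H -> R) K : 0 < K ->
  (forall z w, nonneg_cone R D z -> nonneg_cone R D w ->
    u z - u w <= K * (`|z.1 - w.1| + `|z.2 - w.2|)) ->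
  forall (z : nat -> R * H) l, (forall n, nonneg_cone R D (z n)) -> nonneg_cone R D l ->
    (z n).1 @[n --> \oo] --> l.1 -> (z n).2 @[n --> \oo] --> l.2 ->
    u (z n) @[n --> \oo] --> u l.
Proof.
move=> K0 uK z l zc lc /cvgrPdist_le h1 /cvgrPdist_le h2.
apply/cvgrPdist_le => e e0.
have e1 : 0 < e / (2 * K) by rewrite divr_gt0// mulr_gt0.
near=> n.
have b : K * (`|l.1 - (z n).1| + `|l.2 - (z n).2|) <= e.
  have -> : e = K * (e / (2 * K) + e / (2 * K)).
    by field; rewrite gt_eqF.
  rewrite ler_wpM2l ?(ltW K0)// lerD//; near: n; [exact: h1|exact: h2].
rewrite ler_norml; apply/andP; split.
  rewrite lerNl opprB (le_trans (uK _ _ (zc n) lc))//.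
  by rewrite (distrC (z n).1) (distrC (z n).2).
by rewrite (le_trans (uK _ _ lc (zc n))).
Unshelve. all: by end_near. Qed.

(** Completing the square; the maximum over [r] is reached at K / (2a). *)
Lemma young1 (K a r : R) : 0 < a -> K * r - a * r ^+ 2 <= K ^+ 2 / (4 * a).
Proof.
move=> a0; rewrite ler_pdivlMr ?mulr_gt0//.
have := sqr_ge0 (2 * a * r - K); lra.
Qed.

Section Doubling.
Variables (u v : R * H -> R) (K a mu : R).
Hypotheses (K0 : 0 < K) (a0 : 0 < a) (mu0 : 0 < mu).
Hypothesis uK : forall z w, nonneg_cone R D z -> nonneg_cone R D w ->
    u z - u w <= K * (`|z.1 - w.1| + `|z.2 - w.2|).
Hypothesis vK : forall z w, nonneg_cone R D z -> nonneg_cone R D w ->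
    v z - v w <= K * (`|z.1 - w.1| + `|z.2 - w.2|).
Hypothesis uv0 : forall x, cone R D x -> u (0, x) <= v (0, x).

(** In the last term, the linear part separates the two time derivatives by at least [mu], and the
    square absorbs the linear growth of u - v in time, keeping the supremum finite. *)
Definition doubled (z : V4) : R := u z.1 - v z.2 - a * `|z.1.2 - z.2.2| ^+ 2 -
  a * (z.1.1 - z.2.1) ^+ 2 - mu * (z.1.1 + z.1.1 ^+ 2).

(** Going from (t, x) to (s, y) through (0, x), where u <= v, costs K (t + s + |x - y|) with s <= t
    + |t - s|; each linear term is absorbed by its square. *)
Lemma doubled_le z : good z -> doubled z <= K ^+ 2 / mu + K ^+ 2 / (2 * a).
Proof.
case: z => [[t x] [s y]] [[/= t0 xc] [/= s0 yc]]; rewrite /doubled/=.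
have h1 := uK (conj t0 xc : nonneg_cone R D (t, x)) (conj (lexx 0) xc : nonneg_cone R D (0, x)).
have h2 := vK (conj (lexx 0) xc : nonneg_cone R D (0, x)) (conj s0 yc : nonneg_cone R D (s, y)).
have h3 := uv0 xc; move: h1 h2 => /=.
rewrite !subrr normr0 !addr0 subr0 sub0r normrN !ger0_norm// => h1 h2.
have y1 := young1 K `|x - y| a0; have y2 := young1 K `|t - s| a0.
have y3 := young1 (2 * K) t mu0.
rewrite real_normK ?num_real// in y2.
have st : s <= t + `|t - s| by have := ler_norm (s - t); rewrite distrC; lra.
have -> : K ^+ 2 / (2 * a) = K ^+ 2 / (4 * a) + K ^+ 2 / (4 * a) by field; rewrite gt_eqF.
have e3 : (2 * K) ^+ 2 / (4 * mu) = K ^+ 2 / mu by field; rewrite gt_eqF.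
rewrite e3 in y3.
have Ks := ler_wpM2l (ltW K0) st; have mt := mulr_ge0 (ltW mu0) t0.
move: (K ^+ 2 / mu) (K ^+ 2 / (4 * a)) y1 y2 y3 => c1 c2 y1 y2 y3.
lra.
Qed.

(** When one time is 0, the initial comparison applies at (0, x) or at (0, y), leaving only K (|x -
    y| + |t - s|) to absorb. *)
Lemma doubled_initial_le z : good z -> z.1.1 = 0 \/ z.2.1 = 0 ->
  doubled z <= K ^+ 2 / (2 * a).
Proof.
case: z => [[t x] [s y]] [[/= t0 xc] [/= s0 yc]]; rewrite /doubled/= => ts.
suff : u (t, x) - v (s, y) <= K * `|x - y| + K * `|t - s|.
  have y1 := young1 K `|x - y| a0; have y2 := young1 K `|t - s| a0.
  rewrite real_normK ?num_real// in y2.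
  have -> : K ^+ 2 / (2 * a) = K ^+ 2 / (4 * a) + K ^+ 2 / (4 * a) by field; rewrite gt_eqF.
  have mt := mulr_ge0 (ltW mu0) t0; have mt2 := mulr_ge0 (ltW mu0) (sqr_ge0 t).
  move: (K ^+ 2 / (4 * a)) y1 y2 => c2 y1 y2 h; lra.
case: ts => [t00|s00]; [rewrite t00|rewrite s00].
  have h2 := vK (conj (lexx 0) xc : nonneg_cone R D (0, x)) (conj s0 yc : nonneg_cone R D (s, y)).
  have h3 := uv0 xc; move: h2 => /=; lra.
have h2 := uK (conj t0 xc : nonneg_cone R D (t, x)) (conj (lexx 0) yc : nonneg_cone R D (0, y)).
have h3 := uv0 yc; move: h2 => /=; lra.
Qed.

Lemma doubled_cvg (z : nat -> V4) l : (forall n, good (z n)) -> good l ->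
  (z n).1.1 @[n --> \oo] --> (l.1.1 : R) -> (z n).1.2 @[n --> \oo] --> l.1.2 ->
  (z n).2.1 @[n --> \oo] --> (l.2.1 : R) -> (z n).2.2 @[n --> \oo] --> l.2.2 ->
  doubled (z n) @[n --> \oo] --> doubled l.
Proof.
move=> zg lg h1 h2 h3 h4.
have c1 : u (z n).1 @[n --> \oo] --> u l.1.
  by apply: (lipschitz_cvg K0 uK _ lg.1 h1 h2) => n; exact: (zg n).1.
have c2 : v (z n).2 @[n --> \oo] --> v l.2.
  by apply: (lipschitz_cvg K0 vK _ lg.2 h3 h4) => n; exact: (zg n).2.
have sq (x : nat -> R) (y : R) : x @ \oo --> y -> x n ^+ 2 @[n --> \oo] --> y ^+ 2.
  by move=> xy; exact: (cvg_comp x (fun b => b ^+ 2) xy (@exprn_continuous R 2 _)).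
have mult (b : R) (x : nat -> R) (y : R) : x @ \oo --> y -> b * x n @[n --> \oo] --> b * y.
  by move=> xy; exact: (cvgM (cvg_cst b) xy).
have c3 := mult a _ _ (sq _ _ (cvg_norm (cvgB h2 h4))).
have c4 := mult a _ _ (sq _ _ (cvgB h1 h3)).
have c5 := mult mu _ _ (cvgD h1 (sq _ _ h1)).
rewrite /doubled; apply: cvgB; last exact: c5.
apply: cvgB; last exact: c4.
apply: cvgB; last exact: c3.
by apply: cvgB; [exact: c1|exact: c2].
Qed.

End Doubling.
End Comparison.

(** * Viscosity inequalities at a maximum *)

Section Viscosity.
Variables (R : realType) (D : nat).
Local Notation H := (symL2 R D).
Local Notation V4 := (V4 R D).
Local Notation good := (@good R D).
Variables (F : H -> R) (u v : R * H -> R) (a mu : R).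
Local Notation Phi := (doubled u v a mu).

(** The first perturbation, centred at [m1]; its factor 2 is the 2c of [strong_max] for c = 1. *)
Definition penalized (m1 : H) (z : V4) : R :=
  Phi z - 2 * symL2_dot (z.1.2 - z.2.2 - m1) (z.1.2 - z.2.2 - m1).

(** Expansion with (s, y) frozen. The coefficient a + mu + 2 collects the squares of t from the
    doubling, the time penalty and the second perturbation; a + 4 collects those of x from the
    doubling and both perturbations. *)
Lemma penalized_test_sub (m1 : H) (m : V4) w (s : R) (y : H) :
  penalized m1 (w, (s, y)) - 2 * dot4 ((w, (s, y)) - m) ((w, (s, y)) - m) =
  u w - quad_test (a + mu + 2) (- (2 * a * s) + mu - 4 * m.1.1) (a + 4)
    ((- (2 * a)) *: y - 4 *: (y + m1) - 4 *: m.1.2) w +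
  (- v (s, y) - a * symL2_dot y y - a * s ^+ 2
   - 2 * symL2_dot (y + m1) (y + m1) - 2 * m.1.1 ^+ 2 - 2 * symL2_dot m.1.2 m.1.2
   - 2 * ((s - m.2.1) ^+ 2 + symL2_dot (y - m.2.2) (y - m.2.2))).
Proof.
case: w => t x; case: m => [[mt mx] [ms my]].
rewrite /penalized /doubled /dot4 /quad_test -symL2_dotE2 /=.
rewrite !(symL2_dotBr, symL2_dotBl, symL2_dotD, symL2_dotZ) !(symL2_dotC _ (y + m1)).
rewrite !(symL2_dotBr, symL2_dotBl, symL2_dotD, symL2_dotZ).
rewrite ?(symL2_dotC x y) ?(symL2_dotC x mx) ?(symL2_dotC x m1)
  ?(symL2_dotC m1 y) ?(symL2_dotC my y).
move: (u _) (v _) => ut vs; do ?[move: (symL2_dot _ _) => ?]; ring.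
Qed.

(** With (t, x) frozen the signs are reversed and the penalty in [mu] falls into the constant, so
    that it appears in the inequality for [u] alone. *)
Lemma penalized_test_sup (m1 : H) (m : V4) w (t : R) (x : H) :
  penalized m1 ((t, x), w) - 2 * dot4 (((t, x), w) - m) (((t, x), w) - m) =
  - (v w - quad_test (- (a + 2)) (2 * a * t + 4 * m.2.1) (- (a + 4))
    ((2 * a) *: x + 4 *: (x - m1) + 4 *: m.2.2) w) +
  (u (t, x) - a * symL2_dot x x - a * t ^+ 2 - mu * (t + t ^+ 2)
   - 2 * symL2_dot (x - m1) (x - m1) - 2 * m.2.1 ^+ 2 - 2 * symL2_dot m.2.2 m.2.2
   - 2 * ((t - m.1.1) ^+ 2 + symL2_dot (x - m.1.2) (x - m.1.2))).
Proof.
case: w => s y; case: m => [[mt mx] [ms my]].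
rewrite /penalized /doubled /dot4 /quad_test -symL2_dotE2 /=.
rewrite !(symL2_dotBr, symL2_dotBl, symL2_dotD, symL2_dotZ).
rewrite ?(symL2_dotC y x) ?(symL2_dotC y my) ?(symL2_dotC x m1)
  ?(symL2_dotC y m1) ?(symL2_dotC mx x).
move: (u _) (v _) => ut vs; do ?[move: (symL2_dot _ _) => ?]; ring.
Qed.

Lemma near_within_all (T : topologicalType) (z : T) (A P : set T) :
  (forall w, A w -> P w) -> \forall w \near within A (nbhs z), P w.
Proof. by move=> AP; rewrite near_withinE; exact: nearW. Qed.

(** With the variables of [v] frozen, the maximum makes a quadratic function an admissible test for
    [u]. The three terms of the gradient come from the doubling, the first and the second
    perturbation. *)
Lemma sub_at_max (m1 : H) (m l : V4) : viscosity_subsolution F u -> good l ->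
  0 < l.1.1 ->
  (forall z, good z -> penalized m1 z - 2 * dot4 (z - m) (z - m) <=
                       penalized m1 l - 2 * dot4 (l - m) (l - m)) ->
  2 * a * (l.1.1 - l.2.1) + mu * (1 + 2 * l.1.1) + 4 * (l.1.1 - m.1.1) <=
  F ((2 * a) *: (l.1.2 - l.2.2) + 4 *: (l.1.2 - l.2.2 - m1) + 4 *: (l.1.2 - m.1.2)).
Proof.
case: l => [[t x] [s y]] [_ uS] [[/= _ xc] lg2] t0 lmax.
have zc : pos_cone R D (t, x) by [].
pose phi := quad_test (a + mu + 2) (- (2 * a * s) + mu - 4 * m.1.1) (a + 4)
    ((- (2 * a)) *: y - 4 *: (y + m1) - 4 *: m.1.2).
have wmax : \forall w \near within (pos_cone R D) (nbhs (t, x)),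
    u w - phi w <= u (t, x) - phi (t, x).
  apply: near_within_all => w wc.
  have := lmax (w, (s, y)) (conj (conj (ltW wc.1) wc.2) lg2).
  by rewrite !penalized_test_sub lerD2r.
have := uS (t, x) phi zc (quad_smooth _ _ _ _) wmax.
rewrite /dt /grad /phi quad_jetE// /quad_jet/= subr_le0.
set b := (X in X <= F _ -> _); set q := (X in F X).
have -> : b = 2 * a * (t - s) + mu * (1 + 2 * t) + 4 * (t - m.1.1) by rewrite /b; ring.
have -> : q = (2 * a) *: (x - y) + 4 *: (x - y - m1) + 4 *: (x - m.1.2).
  rewrite /q (_ : 2 * (a + 4) = 2 * a + 4 + 4); last by ring.
  move: (2 * a) 4 => c d; rewrite !scalerDl !scalerBr !scalerDr !scaleNr !opprD !addrA.
  by rewrite [LHS](ACl (1*4*2*5*6*3*7))%AC.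
by [].
Qed.

(** The terms depending on x - y alone give the same gradient as for [u]; the two gradients differ
    only through the second perturbation. *)
Lemma sup_at_max (m1 : H) (m l : V4) : viscosity_supersolution F v -> good l ->
  0 < l.2.1 ->
  (forall z, good z -> penalized m1 z - 2 * dot4 (z - m) (z - m) <=
                       penalized m1 l - 2 * dot4 (l - m) (l - m)) ->
  F ((2 * a) *: (l.1.2 - l.2.2) + 4 *: (l.1.2 - l.2.2 - m1) - 4 *: (l.2.2 - m.2.2)) <=
  2 * a * (l.1.1 - l.2.1) - 4 * (l.2.1 - m.2.1).
Proof.
case: l => [[t x] [s y]] [_ vS] [lg1 [/= _ yc]] s0 lmax.
have zc : pos_cone R D (s, y) by [].
pose phi := quad_test (- (a + 2)) (2 * a * t + 4 * m.2.1) (- (a + 4))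
    ((2 * a) *: x + 4 *: (x - m1) + 4 *: m.2.2).
have wmin : \forall w \near within (pos_cone R D) (nbhs (s, y)),
    v (s, y) - phi (s, y) <= v w - phi w.
  apply: near_within_all => w wc.
  have := lmax ((t, x), w) (conj lg1 (conj (ltW wc.1) wc.2)).
  by rewrite !penalized_test_sup lerD2r lerN2.
have := vS (s, y) phi zc (quad_smooth _ _ _ _) wmin.
rewrite /dt /grad /phi quad_jetE// /quad_jet/= subr_ge0.
set q := (X in F X <= _ -> _); set b := (X in F q <= X -> _).
have -> : b = 2 * a * (t - s) - 4 * (s - m.2.1) by rewrite /b; ring.
have -> : q = (2 * a) *: (x - y) + 4 *: (x - y - m1) - 4 *: (y - m.2.2).
  rewrite /q (_ : 2 * - (a + 4) = - (2 * a) - 4 - 4); last by ring.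
  move: (2 * a) 4 => c d; rewrite !scalerDl !scalerBr !scaleNr !opprD !opprK !addrA.
  by rewrite [LHS](ACl (4*1*5*2*6*3*7))%AC.
by [].
Qed.

End Viscosity.

(** * The two perturbations combined and the comparison principle *)

Lemma norm_le_sqr (R : realType) (D : nat) (x : symL2 R D) (e : R) : 0 < e ->
  symL2_dot x x < e ^+ 2 -> `|x| < e.
Proof.
by move=> e0; rewrite symL2_dotE2 => h; rewrite -ltr_sqr ?nnegrE ?(ltW e0).
Qed.

(* The limit gradient q is fixed before the second perturbation, which is then
   chosen small in terms of the modulus of continuity of F at q. *)
Lemma first_perturbation (R : realType) (D : nat) (u v : R * symL2 R D -> R)
    (a mu M eta : R) (z0 : V4 R D) : 0 < eta ->
  (forall z, good z -> doubled u v a mu z <= M) -> good z0 ->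
  exists m1 l, (exists2 z1, good z1 &
      doubled u v a mu z0 - 66 * eta <= penalized u v a mu m1 z1) /\
    forall r, 0 < r -> exists2 th, 0 < th & forall z, good z ->
      (forall z', good z' -> penalized u v a mu m1 z' <= penalized u v a mu m1 z + th) ->
      `|z.1.2 - z.2.2 - l| < r.
Proof.
move=> eta0 PM z0g; have [z1 z1g z1P] := near_max z0g PM eta0.
pose Z := {z : V4 R D | good z}.
have H_complete (w : nat -> symL2 R D) (C : R) : 0 < C ->
    (forall n, symL2_dot (w n.+1 - w n) (w n.+1 - w n) <= C * 2^-1 ^+ n ^+ 2) ->
    exists l, forall n, symL2_dot (w n - l) (w n - l) <= 16 * C * 2^-1 ^+ n ^+ 2.
  move=> C0 wC; have [l lP] := symL2_fast_cauchy C0 wC.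
  exists l => n; apply: (le_trans (lP n)); rewrite ler_wpM2r ?sqr_ge0//.
  by rewrite ler_wpM2r ?(ltW C0)// ler_nat.
have [m1 [l [z1m _ strong]]] := @strong_max R (symL2 R D) (@symL2_dot R D)
  (@symL2_dotC R D) (@symL2_dot_linear R D) (@symL2_dot_ge0 R D) H_complete
  Z (fun z => doubled u v a mu (sval z)) (fun z => (sval z).1.2 - (sval z).2.2)
  M 1 eta (exist _ z1 z1g) (fun z => PM _ (svalP z)) ltr01 eta0
  (fun z => z1P _ (svalP z)).
rewrite divr1/= in z1m.
exists m1, l; split.
  (* The perturbation costs at most 2 * 32 eta at [z1], itself maximal up to eta; 66 eta covers
     both. *)
  exists z1 => //; rewrite /penalized; have := z1P _ z0g; lra.
move=> r r0; have [th th0 thP] := strong _ (exprn_gt0 2 r0).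
exists th => // z zg zP; apply: norm_le_sqr => //.
have := thP (exist _ z zg); rewrite /= !mulr1; apply=> z'.
exact: zP (svalP z').
Qed.

Lemma penalized_cvg (R : realType) (D : nat) (u v : R * symL2 R D -> R)
    (K a mu : R) (m1 : symL2 R D) : 0 < K ->
  (forall z w, nonneg_cone R D z -> nonneg_cone R D w ->
    u z - u w <= K * (`|z.1 - w.1| + `|z.2 - w.2|)) ->
  (forall z w, nonneg_cone R D z -> nonneg_cone R D w ->
    v z - v w <= K * (`|z.1 - w.1| + `|z.2 - w.2|)) ->
  forall (z : nat -> V4 R D) l, (forall n, good (z n)) -> good l ->
  (z n).1.1 @[n --> \oo] --> (l.1.1 : R) -> (z n).1.2 @[n --> \oo] --> l.1.2 ->
  (z n).2.1 @[n --> \oo] --> (l.2.1 : R) -> (z n).2.2 @[n --> \oo] --> l.2.2 ->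
  penalized u v a mu m1 (z n) @[n --> \oo] --> penalized u v a mu m1 l.
Proof.
move=> K0 uK vK z l zg lg h1 h2 h3 h4.
have c1 := doubled_cvg (a := a) (mu := mu) K0 uK vK zg lg h1 h2 h3 h4.
have c2 : `|(z n).1.2 - (z n).2.2 - m1| @[n --> \oo] --> `|l.1.2 - l.2.2 - m1|.
  exact: (cvg_norm (cvgB (cvgB h2 h4) (cvg_cst m1))).
have c3 := cvg_comp (fun n => `|(z n).1.2 - (z n).2.2 - m1|) (fun b => b ^+ 2)
  c2 (@exprn_continuous R 2 _).
rewrite /penalized symL2_dotE2; under eq_fun do rewrite symL2_dotE2.
apply: cvgB; first exact: c1.
by apply: cvgM; [exact: cvg_cst|exact: c3].
Qed.

Theorem proposition3p8 (R : realType) (D : nat) (hD : (1 <= D)%N)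
    (F : symL2 R D -> R) (hF : locally_lipschitz F)
    (u v : R * symL2 R D -> R)
    (hu : [lipschitz u z | z in nonneg_cone R D])
    (hv : [lipschitz v z | z in nonneg_cone R D])
    (husub : viscosity_subsolution F u)
    (hvsup : viscosity_supersolution F v)
    (h0 : forall x, cone R D x -> u (0, x) <= v (0, x)) :
  forall t x, 0 <= t -> cone R D x -> u (t, x) <= v (t, x).
Proof.
move=> t0 x0 t00 x0c; rewrite leNgt; apply/negP; rewrite -subr_gt0.
set dl := u (t0, x0) - v (t0, x0) => dl0.
have [Ku Ku0 uKu] := lipschitz_nonneg_cone hu.
have [Kv Kv0 vKv] := lipschitz_nonneg_cone hv.
pose K := Ku + Kv; have K0 : 0 < K by rewrite addr_gt0.
have uK z w : nonneg_cone R D z -> nonneg_cone R D w ->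
    u z - u w <= K * (`|z.1 - w.1| + `|z.2 - w.2|).
  move=> zc wc; apply: (le_trans (uKu _ _ zc wc)).
  by rewrite ler_wpM2r ?addr_ge0// lerDl ltW.
have vK z w : nonneg_cone R D z -> nonneg_cone R D w ->
    v z - v w <= K * (`|z.1 - w.1| + `|z.2 - w.2|).
  move=> zc wc; apply: (le_trans (vKv _ _ zc wc)).
  by rewrite ler_wpM2r ?addr_ge0// lerDr ltW.
clearbody K.
have tt1 : 0 < 1 + t0 + t0 ^+ 2 by rewrite ltr_wpDr ?sqr_ge0// ltr_wpDr.
(* Chosen so that the bound K^2 / (2a) at initial times is dl / 8. *)
pose a := 4 * K ^+ 2 / dl.
have a0 : 0 < a by rewrite divr_gt0// mulr_gt0// exprn_gt0.
have K2a : K ^+ 2 / (2 * a) = dl / 8 by rewrite /a; field; rewrite !gt_eqF.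
(* Chosen so that the time penalty costs at most dl / 2 at t0, leaving a value of at least dl / 2 at
   [z0]. *)
pose mu := dl / (2 * (1 + t0 + t0 ^+ 2)).
have mu0 : 0 < mu by rewrite divr_gt0// mulr_gt0.
have mut : mu * (t0 + t0 ^+ 2) <= dl / 2.
  have e : mu * (1 + t0 + t0 ^+ 2) = dl / 2 by rewrite /mu; field; rewrite gt_eqF.
  by rewrite -e ler_pM2l// -addrA lerDr.
clearbody a mu.
pose z0 : V4 R D := ((t0, x0), (t0, x0)).
have z0g : good z0 by [].
have z0P : dl / 2 <= doubled u v a mu z0.
  by rewrite /doubled/= !subrr normr0 expr0n/= !mulr0 !subr0 -/dl; lra.
have PM := @doubled_le R D u v K a mu K0 a0 mu0 uK vK h0.
have Pinit := @doubled_initial_le R D u v K a mu a0 mu0 uK vK h0.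
rewrite K2a in Pinit.
clearbody z0.
(* As 66 * dl / 528 = dl / 8, the first perturbation leaves a value of at least 3 dl / 8 at [z1]. *)
have eta10 : 0 < dl / 528 by rewrite divr_gt0 ?ltr0n.
have [m1 [l [[z1 z1g z1P] strong]]] := first_perturbation eta10 PM z0g.
(* The gradient of the doubling and first perturbation terms at the limit [l] of x - y. *)
pose q := (2 * a) *: l + 4 *: (l - m1).
have mu4 : 0 < mu / 4 by rewrite divr_gt0.
have [r0 r00 Fq] := locally_lipschitz_cvg q hF mu4.
have a4 : 0 < 2 * (2 * a + 4) by rewrite mulr_gt0// addr_gt0// mulr_gt0.
have [th th0 thP] := strong _ (divr_gt0 r00 a4).
(* With r0 / 16 the second perturbation moves the gradients by at most r0 / 4, while x - y, close to
   [l], moves them by less than r0 / 2. With mu / 64 it changes the gap between time derivatives by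
   at most mu / 8. *)
pose tau := Num.min (r0 / 16) (mu / 64).
have tau0 : 0 < tau by rewrite lt_min !divr_gt0.
have tau_r0 : tau <= r0 / 16 by rewrite ge_min lexx.
have tau_mu : tau <= mu / 64 by rewrite ge_min lexx orbT.
(* The three bounds keep the final maximizer, in turn, maximal up to [th] for the first perturbed
   function, away from initial times as 65 * dl / 1040 = dl / 16, and within [tau] of the centre
   [m2] in each variable. *)
pose eta := Num.min (th / 65) (Num.min (dl / 1040) (tau ^+ 2 / 128)).
have eta0 : 0 < eta by rewrite !lt_min !divr_gt0 ?exprn_gt0 ?ltr0n.
have eta_th : 65 * eta <= th by rewrite -ler_pdivlMl// mulrC ge_min lexx.
have eta_dl : 65 * eta <= dl / 16.
  have : eta <= dl / 1040 by rewrite !ge_min lexx orbT.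
  lra.
have eta_tau : 128 * eta <= tau ^+ 2.
  by rewrite -ler_pdivlMl// mulrC !ge_min lexx !orbT.
clearbody tau eta.
pose Phi := penalized u v a mu m1.
have Phi_le z : Phi z <= doubled u v a mu z.
  by rewrite /Phi /penalized gerBl mulr_ge0// symL2_dot_ge0.
have PhiM z : good z -> Phi z <= K ^+ 2 / mu + K ^+ 2 / (2 * a).
  by move=> zg; exact: le_trans (Phi_le z) (PM z zg).
have [z2 z2g z2P] := near_max z1g PhiM eta0.
have [m2 [w [wg z2m wm wmax]]] := attained_max PhiM eta0 z2g z2P
  (@penalized_cvg R D u v K a mu m1 K0 uK vK).
(* Of the 65, one comes from the choice of [z2] and 2 * 32 from the second perturbation at [z2]. *)
have w_near z : good z -> Phi z <= Phi w + 65 * eta.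
  move=> zg.
  have h2 : Phi z2 - 2 * dot4 (z2 - m2) (z2 - m2) <= Phi w - 2 * dot4 (w - m2) (w - m2).
    exact: wmax.
  move: (z2P z zg) h2 z2m (dot4_ge0 (w - m2)).
  move: (dot4 _ _) (dot4 _ _) (Phi z) (Phi z2) (Phi w) => b1 b2 b3 b4 b5.
  clear; lra.
have [wm1 wm2 wm3 wm4] := dot4_components (ltW tau0) (le_trans wm eta_tau).
have wl := thP w wg (fun z zg => le_trans (w_near z zg) (lerD (lexx _) eta_th)).
(* The value is at least 3 dl / 8 - dl / 16, above the bound dl / 8 valid at initial times; both
   times of [w] are therefore positive. *)
have w_val : dl / 8 < doubled u v a mu w.
  move: (w_near z1 z1g) (Phi_le w) z1P z0P eta_dl dl0; rewrite -/(Phi z1).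
  move: (Phi _) (Phi _) (doubled _ _ _ _ _) (doubled _ _ _ _ _) => b1 b2 b3 b4.
  clear; lra.
have wt : 0 < w.1.1.
  rewrite lt_def wg.1.1 andbT; apply/eqP => w0.
  by have := Pinit w wg (or_introl w0); rewrite leNgt w_val.
have ws : 0 < w.2.1.
  rewrite lt_def wg.2.1 andbT; apply/eqP => w0.
  by have := Pinit w wg (or_intror w0); rewrite leNgt w_val.
have hsub := sub_at_max husub wg wt wmax.
have hsup := sup_at_max hvsup wg ws wmax.
have F_near y : `|y| <= tau -> `|F ((2 * a) *: (w.1.2 - w.2.2) +
    4 *: (w.1.2 - w.2.2 - m1) + 4 *: y) - F q| < mu / 4.
  move=> yt; apply: Fq; set d := w.1.2 - w.2.2 in wl *; clearbody d.
  have -> : (2 * a) *: d + 4 *: (d - m1) + 4 *: y - q =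
      (2 * a + 4) *: (d - l) + 4 *: y.
    rewrite /q; move: (2 * a) 4 => c e; rewrite scalerDl !scalerBr !opprD !opprK !addrA.
    rewrite [LHS](ACl ((1*5*2*6*4)*(3*7)))%AC/=.
    by rewrite addNr addr0.
  apply: (le_lt_trans (ler_normD _ _)).
  rewrite !normrZ !gtr0_norm ?addr_gt0 ?mulr_gt0//.
  move: wl; rewrite ltr_pdivlMr//; move: yt tau_r0 r00.
  move: `|y| `|d - l| => b1 b2; clear; lra.
have F1 := F_near _ wm2.
have F2 : `|F ((2 * a) *: (w.1.2 - w.2.2) + 4 *: (w.1.2 - w.2.2 - m1) -
    4 *: (w.2.2 - m2.2.2)) - F q| < mu / 4.
  by rewrite -scalerN; apply: F_near; rewrite normrN.
(* The two values of [F] differ by less than mu / 2, whereas the time derivatives differ by at least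
   mu - 8 tau, hence by at least 7 mu / 8. *)
move: hsub hsup F1 F2.
move: (F q) (F _) (F _) => f0 f1 f2 hsub hsup.
rewrite !ltr_norml => /andP[_ hf1] /andP[hf2 _].
move: wm1 wm3; rewrite !ler_norml => /andP[h1 _] /andP[h2 _].
have h3 := mulr_gt0 mu0 wt.
move: hsub hsup hf1 hf2 h1 h2 h3 tau_mu; rewrite /=.
move: w.1.1 m2.1.1 w.2.1 m2.2.1 => b1 b2 b3 b4; clear -mu0; lra.
Qed.
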